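(* Let $S$ be a finite non-empty set and $\Sigma\subseteq\mathbb{R}_+\times S$ locally finite, and let $(X_n,\eta_n)$ be a time-homogeneous irreducible Markov chain on $\Sigma$ such that every line $\Lambda_k=\{x\in\mathbb{R}_+:(x,k)\in\Sigma\}$, $k\in S$, is unbounded. Suppose that for some $p>2$ there is $C_p<\infty$ with $\mathbb{E}_{x,i}[|X_{n+1}-X_n|^p]\le C_p$ for all $(x,i)\in\Sigma$. Suppose that $q_{ij}(x)\to q_{ij}$ as $x\to\infty$ for all $i,j\in S$, where $(q_{ij})$ is an irreducible stochastic matrix with stationary distribution $\pi$. Suppose there exist $c_i\in\mathbb{R}$ and $s_i^2\ge0$, $i\in S$, with at least one $s_i^2\neq0$, such that $\mu_i(x)=\frac{c_i}{x}+o(x^{-1})$ and $\sigma_i^2(x)=s_i^2+o(1)$ as $x\to\infty$. If for some $\theta\in(0,\frac p2]$ \[\sum_{i\in S}\left[2c_i+(2\theta-1)s_i^2\right]\pi_i>0,\] then for any $s\ge\theta$ we have $\mathbb{E}[\tau_x^s]=\infty$ for all sufficiently large $X_0>x$.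
   Context: Locally finite means $\Sigma\cap([0,r]\times S)$ is finite for every $r\ge0$. Write $\mathbb{E}_{x,i}[\cdot]=\mathbb{E}[\cdot\mid X_n=x,\eta_n=i]$ and $\Pr_{x,i}$ similarly. Define $q_{ij}(x)=\Pr_{x,i}[\eta_{n+1}=j]$, $\mu_i(x)=\mathbb{E}_{x,i}[X_{n+1}-X_n]$, $\sigma_i^2(x)=\mathbb{E}_{x,i}[(X_{n+1}-X_n)^2]$. The stationary distribution $\pi=(\pi_i)_{i\in S}$ is the unique probability vector with $\pi_j=\sum_i\pi_iq_{ij}$. For $x\in\mathbb{R}_+$, $\tau_x=\min\{n\ge0: X_n\le x\}$. *)

(* Defs.v *)
From HB Require Import structures.
From mathcomp Require Import all_boot all_order all_algebra.
From mathcomp Require Import all_classical all_reals all_analysis.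
Set Implicit Arguments. Unset Strict Implicit. Unset Printing Implicit Defensive.
Import Order.TTheory GRing.Theory Num.Theory.
Local Open Scope classical_set_scope.
Local Open Scope ring_scope.

Section MC.
Context {R : realType} {S : finType}.

Definition locally_finite_subset (Sig : set (R * S)) : Prop :=
  (forall z, Sig z -> 0 <= z.1) /\
  (forall r : R, 0 <= r -> finite_set (Sig `&` [set z | 0 <= z.1 <= r])).

Definition stochastic_kernel (Sig : set (R * S)) (K : R * S -> R * S -> R) : Prop :=
  (forall z w, 0 <= K z w) /\
  (forall z w, Sig z -> K z w != 0 -> Sig w) /\
  (forall z, Sig z -> (\esum_(w in Sig) (K z w)%:E = 1)%E).

Definition kernel_irreducible (Sig : set (R * S)) (K : R * S -> R * S -> R) : Prop :=
  forall z w, Sig z -> Sig w ->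
    exists (n : nat) (path : nat -> R * S),
      path 0%N = z /\ path n = w /\ (forall k, (k < n)%N -> 0 < K (path k) (path k.+1)).

Definition qx (Sig : set (R * S)) (K : R * S -> R * S -> R) (i j : S) (x : R) : R :=
  fine (\esum_(w in Sig `&` [set w | w.2 = j]) (K (x, i) w)%:E).

Definition mux (Sig : set (R * S)) (K : R * S -> R * S -> R) (i : S) (x : R) : R :=
  fine (\esum_(w in Sig) (K (x, i) w * Num.max (w.1 - x) 0)%:E) -
  fine (\esum_(w in Sig) (K (x, i) w * Num.max (x - w.1) 0)%:E).

Definition sigma2x (Sig : set (R * S)) (K : R * S -> R * S -> R) (i : S) (x : R) : R :=
  fine (\esum_(w in Sig) (K (x, i) w * (w.1 - x) ^+ 2)%:E).

Definition pmoment (Sig : set (R * S)) (K : R * S -> R * S -> R) (p : R) (z : R * S) : \bar R :=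
  \esum_(w in Sig) (K z w * (`|w.1 - z.1| `^ p))%:E.

Definition irreducible_stochastic (Q : S -> S -> R) : Prop :=
  (forall i j, 0 <= Q i j) /\ (forall i, \sum_j Q i j = 1) /\
  (forall i j, exists (n : nat) (path : nat -> S),
      path 0%N = i /\ path n = j /\ (forall k, (k < n)%N -> 0 < Q (path k) (path k.+1))).

Definition stationary_distribution (Q : S -> S -> R) (pi : S -> R) : Prop :=
  (forall i, 0 <= pi i) /\ \sum_i pi i = 1 /\ (forall j, pi j = \sum_i pi i * Q i j).

(* Z = (X_n, eta_n) on (Omega, P) is a time-homogeneous Markov chain with
   transition kernel K started at z0: its finite-dimensional distributions are
   P(Z_0 = w_0, ..., Z_n = w_n) = 1{w_0 = z0} * prod_{k<n} K(w_k, w_{k+1}). *)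
Definition is_markov_chain d (Omega : measurableType d) (P : probability Omega R)
    (K : R * S -> R * S -> R) (z0 : R * S) (Z : nat -> Omega -> R * S) : Prop :=
  (forall n w, measurable [set om | Z n om = w]) /\
  (forall (n : nat) (path : nat -> R * S),
      P [set om | forall k, (k <= n)%N -> Z k om = path k] =
      (((path 0%N == z0)%:R * \prod_(k < n) K (path k) (path k.+1))%:E)).

(* tau_x = min {n >= 0 : X_n <= x}, = +oo if no such n *)
Definition hitting_time (Omega : Type) (Z : nat -> Omega -> R * S) (x : R) (om : Omega) : \bar R :=
  ereal_inf [set (n%:R)%:E | n in [set n : nat | (Z n om).1 <= x]].

End MC.

(* Main.v *)
Require Import Defs.
From HB Require Import structures.
From mathcomp Require Import all_boot all_order all_algebra.
From mathcomp Require Import all_classical all_reals all_analysis.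
From mathcomp Require Import ring lra.
Import Order.TTheory GRing.Theory Num.Theory.
Local Open Scope classical_set_scope.
Local Open Scope ring_scope.

(** Put [nu = 2 th] with [th < theta] close to [theta]. Solving a
    Poisson equation for the irreducible matrix [Q] yields [b >= 0] such that
    [x^nu (1 + b_i / x^2)] has positive drift at all high levels. Cut off at
    height [2y], it shows that from a fixed high starting point the chain
    reaches level [y] before level [l] with probability at least of order
    [y^-nu]; a quadratic barrier shows that from level [y] it then needs more
    than [n] steps, [n] of order [y^2], to come back below [y/2], with
    probability at least 1/2. Hence [P(tau > n)] is at least of order [n^-th],
    so [E tau^s >= (n+1)^s P(tau > n)] is unbounded in [n]. No stopping times
    are needed: both estimates are inductions on [n] for
    [P_z(X_0, ..., X_n > l)], computed from the kernel alone. *)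

(** * Poisson equation for an irreducible stochastic matrix *)

Section poisson_equation.
Context {R : realType} {S : finType}.
Implicit Types (Q : S -> S -> R) (pi : S -> R).

(* Maximum principle: the set where [u] attains its maximum is closed under
   the transitions of [Q]. *)
Lemma harmonic_const Q (u : S -> R) : irreducible_stochastic Q ->
  (forall i, \sum_j Q i j * u j = u i) -> forall i j, u i = u j.
Proof.
move=> [Q0 [Q1 Qirr]] uharm.
suff cst k : exists m, u k <= u m /\ (forall j, u m = u j).
  by move=> i j; have [m [_ um]] := cst i; rewrite -!um.
have [m _ um] := @arg_maxP _ _ _ k predT u isT.
exists m; split; first exact: um.
have step i j : u i = u m -> 0 < Q i j -> u j = u m.
  move=> ui Qij.
  (* The mean of [u m - u] under row [i] is zero while its terms are nonnegative, so each term
     vanishes. *)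
  have s0 : \sum_l Q i l * (u m - u l) = 0.
    under eq_bigr do rewrite mulrBr.
    by rewrite sumrB -mulr_suml Q1 mul1r uharm ui subrr.
  have t0 l : 0 <= Q i l * (u m - u l).
    by rewrite mulr_ge0// subr_ge0; exact: um.
  have /eqP := s0; rewrite psumr_eq0// => /allP /(_ j).
  rewrite mem_index_enum => /(_ isT)/=.
  by rewrite mulf_eq0 gt_eqF//= subr_eq0 => /eqP.
move=> j; have [n [path [p0 [pn pstep]]]] := Qirr m j.
suff H l : (l <= n)%N -> u (path l) = u m by rewrite -pn H.
elim: l => [|l IH] ln; first by rewrite p0.
by apply: (step (path l)); [exact/IH/ltnW|exact: pstep].
Qed.

(** Fredholm alternative for [M = Q - 1]: harmonic functions are constant, so [M] has corank at most
    one, its left kernel is the line spanned by [pi], and a vector orthogonal to [pi] lies in the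
    column space of [M]. *)
Lemma poisson_equation Q pi (a : S -> R) : irreducible_stochastic Q ->
  stationary_distribution Q pi -> \sum_i pi i * a i = 0 ->
  exists b : S -> R, forall i, \sum_j Q i j * b j - b i = a i.
Proof.
move=> HQ [pi0 [pi1 pist]] pia.
have reidx (F : S -> R) : \sum_i F i = \sum_(k < #|S|) F (enum_val k).
  by rewrite (reindex (@enum_val S S))//; apply/onW_bij/enum_val_bij.
pose M := \matrix_(i < #|S|, j < #|S|) Q (enum_val i) (enum_val j) - 1%:M.
pose rv (f : S -> R) := \row_(i < #|S|) f (enum_val i) : 'rV[R]_#|S|.
have piM : rv pi *m M = 0.
  rewrite mulmxBr mulmx1; apply/rowP => j; rewrite !mxE.
  rewrite [X in X - _](_ : _ = pi (enum_val j)) ?subrr//.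
  by rewrite [RHS]pist reidx; apply: eq_bigr => i _; rewrite !mxE.
have kerT (v : 'rV[R]_#|S|) : v *m M^T = 0 -> (v <= rv (fun=> 1%R))%MS.
  move=> vM.
  have vh k : \sum_j Q (enum_val k) (enum_val j) * v 0 j = v 0 k.
    move/rowP : vM => /(_ k); rewrite linearB /= trmx1 mulmxBr mulmx1 !mxE.
    move/eqP; rewrite subr_eq0 => /eqP <-.
    by apply: eq_bigr => j _; rewrite !mxE mulrC.
  have c := @harmonic_const Q (fun s => v 0 (enum_rank s)) HQ.
  have {}c : forall i j : S, v 0 (enum_rank i) = v 0 (enum_rank j).
    apply: c => i; rewrite reidx -vh; apply: eq_bigr => j _.
    by rewrite enum_rankK enum_valK.
  have [k _] : exists k : 'I_#|S|, true.
    have := pi1; case: (pickP 'I_#|S|) => [k _|S0]; first by exists k.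
    rewrite reidx big_pred0 => [/eqP|k]; last by have := S0 k.
    by rewrite eq_sym oner_eq0.
  have -> : v = v 0 k *: rv (fun=> 1).
    by apply/rowP => j; rewrite !mxE mulr1 -[k]enum_valK -[j in LHS]enum_valK.
  exact: scalemx_sub.
(* The left and right kernels of a square matrix have the same dimension, and the right kernel
   contains only constants. *)
have rM : (\rank (kermx M) <= 1)%N.
  rewrite mxrank_ker -mxrank_tr -mxrank_ker.
  apply: leq_trans (rank_leq_row (rv (fun=> 1%R))); apply: mxrankS.
  apply/row_subP => i; apply: kerT; apply/eqP.
  by rewrite -sub_kermx row_sub.
have pik : (rv pi <= kermx M)%MS by rewrite sub_kermx piM.
have pin0 : rv pi != 0.
  apply/eqP => /rowP h; have /eqP := pi1; rewrite reidx big1 ?(eq_sym 0) ?oner_eq0//.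
  by move=> k _; have := h k; rewrite !mxE.
have kpi : (kermx M <= rv pi)%MS.
  rewrite -(geq_leqif (mxrank_leqif_sup pik)).
  by apply: (leq_trans rM); rewrite lt0n mxrank_eq0.
(* The transposed columns of [cokermx M^T] lie in the left kernel of [M], so they are multiples of
   [pi] and orthogonal to [a]. *)
have : (rv a <= M^T)%MS.
  rewrite submxE; apply/eqP/rowP => k.
  have /sub_rVP [t ct] : (row k (cokermx M^T)^T <= rv pi)%MS.
    apply: submx_trans kpi; rewrite sub_kermx -row_mul.
    by rewrite -[M in _ *m M]trmxK -trmx_mul mulmx_coker trmx0 row0.
  rewrite !mxE.
  transitivity (t * \sum_i pi i * a i); last by rewrite pia mulr0.
  rewrite reidx mulr_sumr; apply: eq_bigr => j _.
  move/rowP : ct => /(_ j); rewrite !mxE => ->; ring.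
case/submxP => D aD; exists (fun s => D 0 (enum_rank s)) => i.
have /rowP/(_ (enum_rank i)) := aD.
rewrite linearB /= trmx1 mulmxBr mulmx1 !mxE enum_rankK => ->.
rewrite reidx; congr (_ - _); apply: eq_bigr => j _.
by rewrite !mxE enum_valK enum_rankK mulrC.
Qed.

(** The correction [b] replaces the line-dependent drift [d] by its mean under [pi]. It solves the
    Poisson equation with the centred right side [D - d]; a constant shift then makes it nonnegative
    and leaves [Q b - b] unchanged, because the rows of [Q] sum to 1. *)
Lemma drift_corrector Q pi (d : S -> R) : irreducible_stochastic Q ->
  stationary_distribution Q pi ->
  exists b : S -> R, (forall i, 0 <= b i) /\
    forall i, d i + (\sum_j Q i j * b j - b i) = \sum_j d j * pi j.
Proof.
move=> HQ Hpi; set D := \sum_j _.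
have [|b hb] := @poisson_equation Q pi (fun i => D - d i) HQ Hpi.
  under eq_bigr do rewrite mulrBr.
  rewrite sumrB -mulr_suml Hpi.2.1 mul1r; apply/eqP; rewrite subr_eq0; apply/eqP.
  by apply: eq_bigr => i _; rewrite mulrC.
pose B := \sum_j `|b j|.
have bB i : `|b i| <= B.
  by rewrite /B (bigD1 i)//= lerDl sumr_ge0.
exists (fun i => b i + B); split => i.
  by have := bB i; rewrite ler_norml => /andP[]; lra.
have := hb i; under [\sum_j Q i j * (b j + B)]eq_bigr do rewrite mulrDr.
by rewrite big_split/= -mulr_suml HQ.2.1 mul1r; lra.
Qed.

End poisson_equation.

(** * Weighted sums and means of real functions *)

Section weighted_mean.
Context {R : realType} {T : choiceType} (D : set T) (k : T -> R).
Context (k0 : forall w, 0 <= k w).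
Implicit Types (f g a b : T -> R) (c : R).

Definition wsum f : \bar R := \esum_(w in D) (k w * f w)%:E.

Definition wsummable f := (wsum (fun w => `|f w|)%R < +oo)%E.

(** Split into positive and negative parts as in [mux]. It is the true mean only for [wsummable]
    functions, since [fine] sends an infinite sum to 0. *)
Definition wmean f : R :=
  fine (wsum (fun w => Num.max (f w) 0)) - fine (wsum (fun w => Num.max (- f w) 0)).

Lemma wsum_ge0 f : (forall w, D w -> 0 <= f w) -> (0 <= wsum f)%E.
Proof. by move=> f0; apply: esum_ge0 => w Dw; rewrite lee_fin mulr_ge0// f0. Qed.

Lemma le_wsum f g : (forall w, D w -> f w <= g w) -> (wsum f <= wsum g)%E.
Proof. by move=> fg; apply: le_esum => w Dw; rewrite lee_fin ler_wpM2l// fg. Qed.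

Lemma eq_wsum f g : (forall w, D w -> f w = g w) -> wsum f = wsum g.
Proof. by move=> fg; apply: eq_esum => w Dw; rewrite fg. Qed.

Lemma wsumD f g : (forall w, D w -> 0 <= f w) -> (forall w, D w -> 0 <= g w) ->
  wsum (fun w => f w + g w) = (wsum f + wsum g)%E.
Proof.
move=> f0 g0; rewrite /wsum -esumD; last 2 first.
- by move=> w Dw; rewrite lee_fin mulr_ge0// f0.
- by move=> w Dw; rewrite lee_fin mulr_ge0// g0.
by apply: eq_esum => w _; rewrite mulrDr.
Qed.

(** Finite partial sums give one inequality for every nonnegative factor; the same inequality for
    [c^-1] gives the converse. *)
Lemma wsumZ c f : 0 <= c -> (forall w, 0 <= f w) ->
  wsum (fun w => c * f w) = (c%:E * wsum f)%E.
Proof.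
have le (c' : R) g : 0 <= c' -> (forall w, 0 <= g w) ->
    (wsum (fun w => c' * g w)%R <= c'%:E * wsum g)%E.
  move=> c0 g0; apply: ge_ereal_sup => _ [X [finX XD] <-].
  under eq_fsbigr do rewrite mulrCA EFinM.
  rewrite -ge0_mule_fsumr; last by move=> w; rewrite lee_fin mulr_ge0.
  by rewrite lee_wpmul2l ?lee_fin//; apply: ereal_sup_ubound; exists X.
rewrite le_eqVlt => /predU1P[<-|c0] f0.
  by rewrite mul0e; apply: esum1 => w _; rewrite mul0r mulr0.
apply/eqP; rewrite eq_le le ?(ltW c0)//=.
have /le/(_ (fun w => mulr_ge0 (ltW c0) (f0 w))) : 0 <= c^-1 by rewrite invr_ge0 ltW.
rewrite (_ : wsum _ = wsum f); last first.
  by apply: eq_wsum => w _; rewrite mulKf// gt_eqF.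
move=> h; have c0E : (0 <= c%:E)%E by rewrite lee_fin ltW.
apply: le_trans (lee_wpmul2l c0E h) _.
by rewrite muleA -EFinM divff ?gt_eqF// mul1e.
Qed.

Lemma wsummable_le f g : (forall w, D w -> `|f w| <= `|g w|) -> wsummable g ->
  wsummable f.
Proof. by move=> fg; apply: le_lt_trans; exact: le_wsum. Qed.

Lemma wsummableD f g : wsummable f -> wsummable g ->
  wsummable (fun w => f w + g w).
Proof.
rewrite /wsummable => sf sg.
apply: (@le_lt_trans _ _ (wsum (fun w => `|f w|)%R + wsum (fun w => `|g w|)%R))%E.
  by rewrite -wsumD//; apply: le_wsum => w _; exact: ler_normD.
exact: lte_add_pinfty.
Qed.

Lemma wsummableZ c f : wsummable f -> wsummable (fun w => c * f w).
Proof.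
move=> sf; rewrite /wsummable.
under [X in wsum X]eq_fun do rewrite normrM.
rewrite wsumZ//; have := sf; rewrite /wsummable.
have : (0 <= wsum (fun w => `|f w|)%R)%E by exact: wsum_ge0.
by case: wsum => // r _ _; rewrite -EFinM ltry.
Qed.

Lemma wsum_fin f : (forall w, D w -> 0 <= f w) -> wsummable f ->
  wsum f \is a fin_num.
Proof.
move=> f0 sf; rewrite ge0_fin_numE; last exact: wsum_ge0.
by apply: le_lt_trans sf; apply: le_wsum => w _; exact: ler_norm.
Qed.

(** The mean does not depend on the decomposition into nonnegative parts: adding crosswise gives two
    expressions of one nonnegative sum. Linearity of [wmean] is derived from this. *)
Lemma wmean_sub f a b : (forall w, D w -> 0 <= a w) -> (forall w, D w -> 0 <= b w) ->
  wsummable a -> wsummable b -> (forall w, D w -> f w = a w - b w) ->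
  wmean f = fine (wsum a) - fine (wsum b).
Proof.
move=> a0 b0 sa sb fab.
have m0 g w : 0 <= Num.max (g w) 0 :> R by rewrite le_max lexx orbT.
have sp : wsummable (fun w => Num.max (f w) 0).
  apply: (@wsummable_le _ a) sa => w Dw; rewrite (ger0_norm (m0 f w)) ger0_norm ?a0//.
  by rewrite ge_max a0// fab// andbT gerBl b0.
have sn : wsummable (fun w => Num.max (- f w) 0).
  apply: (@wsummable_le _ b) sb => w Dw.
  rewrite (ger0_norm (m0 (fun w => - f w) w)) ger0_norm ?b0//.
  by rewrite ge_max b0// fab// andbT opprB gerBl a0.
rewrite /wmean; set p := wsum (fun w => Num.max (f w) 0).
set n := wsum (fun w => Num.max (- f w) 0).
suff pn : fine p + fine (wsum b) = fine (wsum a) + fine n.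
  by apply/eqP; rewrite subr_eq addrAC -pn addrK.
have fp : p \is a fin_num by apply: wsum_fin sp => w _; exact: m0.
have fn : n \is a fin_num by apply: wsum_fin sn => w _; exact: (m0 (fun w => - f w)).
have [fa fb] := (wsum_fin _ a0 sa, wsum_fin _ b0 sb).
rewrite -!fineD// /p /n -!wsumD//; try by move=> w _; rewrite le_max lexx orbT.
congr fine; apply: eq_wsum => w Dw.
by have := fab _ Dw; case: (leP (f w) 0) => h; case: (leP (- f w) 0) => h'; lra.
Qed.

Lemma wmean_ge0E f : (forall w, D w -> 0 <= f w) -> wsummable f ->
  wmean f = fine (wsum f).
Proof.
move=> f0 sf; have w0 : wsum (fun=> 0) = 0%E by apply: esum1 => w _; rewrite mulr0.
rewrite (@wmean_sub f f (fun=> 0)) ?w0 ?subr0//.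
- by rewrite /wsummable; under eq_fun do rewrite normr0; rewrite w0 ltry.
- by move=> w _; rewrite subr0.
Qed.

Lemma wsummableN f : wsummable f -> wsummable (fun w => - f w).
Proof. by apply: wsummable_le => w _; rewrite normrN. Qed.

Let max_ge0 f w : 0 <= Num.max (f w) 0 :> R.
Proof. by rewrite le_max lexx orbT. Qed.

Let wsummable_max f : wsummable f -> wsummable (fun w => Num.max (f w) 0).
Proof.
apply: wsummable_le => w _; rewrite (ger0_norm (max_ge0 _ _)).
by rewrite ge_max ler_norm/=.
Qed.

Let wsum_max_fin f : wsummable f -> wsum (fun w => Num.max (f w) 0) \is a fin_num.
Proof.
by move=> sf; apply: wsum_fin => [w _|]; [exact: max_ge0|exact: wsummable_max].
Qed.

Let wsum_maxN_fin f : wsummable f -> wsum (fun w => Num.max (- f w) 0) \is a fin_num.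
Proof. by move=> sf; exact: (wsum_max_fin _ (wsummableN _ sf)). Qed.

Let maxB f w : f w = Num.max (f w) 0 - Num.max (- f w) 0.
Proof. by case: (leP (f w) 0) => h; case: (leP (- f w) 0) => h'; lra. Qed.

Lemma wmeanD f g : wsummable f -> wsummable g ->
  wmean (fun w => f w + g w) = wmean f + wmean g.
Proof.
move=> sf sg.
rewrite (@wmean_sub _ (fun w => Num.max (f w) 0 + Num.max (g w) 0)
                      (fun w => Num.max (- f w) 0 + Num.max (- g w) 0)).
- rewrite !wsumD; try by move=> w _; rewrite le_max lexx orbT.
  rewrite (fineD (wsum_max_fin _ sf) (wsum_max_fin _ sg)).
  rewrite (fineD (wsum_maxN_fin _ sf) (wsum_maxN_fin _ sg)).
  by rewrite /wmean opprD addrACA.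
- by move=> w _; rewrite addr_ge0// le_max lexx orbT.
- by move=> w _; rewrite addr_ge0// le_max lexx orbT.
- by apply: wsummableD; exact: wsummable_max.
- by apply: wsummableD; apply: (@wsummable_max (fun w => - _ w)); exact: wsummableN.
- by move=> w _; rewrite {1}(maxB f w) {1}(maxB g w) opprD addrACA.
Qed.

Lemma wmeanN f : wmean (fun w => - f w) = - wmean f.
Proof.
rewrite /wmean opprB; congr (_ - fine _).
by apply: eq_wsum => w _; rewrite opprK.
Qed.

Lemma wmeanZ c f : wsummable f -> wmean (fun w => c * f w) = c * wmean f.
Proof.
have pos (c' : R) g : 0 <= c' -> wsummable g -> wmean (fun w => c' * g w) = c' * wmean g.
  move=> c0 sg; rewrite (@wmean_sub _ (fun w => c' * Num.max (g w) 0)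
    (fun w => c' * Num.max (- g w) 0)).
  - rewrite !wsumZ//; try by move=> w; rewrite le_max lexx orbT.
    rewrite (fineM _ (wsum_max_fin _ sg))// (fineM _ (wsum_maxN_fin _ sg))//.
    by rewrite /wmean mulrBr.
  - by move=> w _; rewrite mulr_ge0// le_max lexx orbT.
  - by move=> w _; rewrite mulr_ge0// le_max lexx orbT.
  - exact/wsummableZ/wsummable_max.
  - exact/wsummableZ/(wsummable_max _ (wsummableN _ sg)).
  - by move=> w _; rewrite -mulrBr -maxB.
move=> sf; have [c0|c0] := leP 0 c; first exact: pos.
rewrite -[c]opprK mulNr -pos ?oppr_ge0 ?ltW// -wmeanN.
by congr wmean; apply/funext => w; rewrite mulNr.
Qed.

Lemma ler_wmean f g : wsummable f -> wsummable g ->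
  (forall w, D w -> f w <= g w) -> wmean f <= wmean g.
Proof.
move=> sf sg fg; rewrite -subr_ge0 -wmeanN -wmeanD//; last exact: wsummableN.
have gf0 w : D w -> 0 <= g w - f w by move=> Dw; rewrite subr_ge0 fg.
rewrite wmean_ge0E//; last exact/wsummableD/wsummableN.
exact/fine_ge0/wsum_ge0.
Qed.

End weighted_mean.

(** * Expansions of real powers near 1 *)

Section power_bounds.
Import numFieldNormedType.Exports.
Context {R : realType}.

Lemma powR_taylor1 (a e : R) : 0 < e ->
  exists2 del : R, 0 < del & forall h : R, `|h| <= del ->
    `|(1 + h) `^ a - 1 - a * h| <= e * `|h|.
Proof.
move=> e0.
have [dv dE] := @is_derive1_powR R a 1 ltr01.
have : (h : R)^-1 * ((h * 1 + 1) `^ a - 1 `^ a) @[h --> 0^'] --> (a * 1 `^ (a - 1) : R).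
  by rewrite -dE; exact: dv.
rewrite powR1 mulr1 => /cvgrPdist_le/(_ e e0).
rewrite near_withinE => -[d /= d0 H].
exists (d / 2) => [|h hd]; first by rewrite divr_gt0.
have [->|h0] := eqVneq h 0.
  by rewrite addr0 powR1 mulr0 normr0 mulr0 subrr subr0 normr0.
have := H h; rewrite /= sub0r normrN => /(_ _ h0).
rewrite mulr1 (addrC h).
have {}hd : `|h| < d by apply: le_lt_trans hd _; rewrite ltr_pdivrMr// ltr_pMr// ltr1n.
move=> /(_ hd); rewrite distrC => H'.
have -> : (1 + h) `^ a - 1 - a * h = (h^-1 * ((1 + h) `^ a - 1) - a) * h by field.
by rewrite normrM ler_wpM2r.
Qed.

Lemma powR_near1 (a e : R) : 0 < e ->
  exists2 del : R, 0 < del & forall h : R, `|h| <= del -> 1 - e <= (1 + h) `^ a.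
Proof.
move=> e0; have [d d0 H] := @powR_taylor1 a 1 ltr01.
exists (Num.min d (e / (1 + `|a|))).
  by rewrite lt_min d0 divr_gt0// ltr_wpDr.
move=> h; rewrite le_min => /andP[/H hd].
rewrite ler_pdivlMr ?ltr_wpDr// => he.
have := ler_norm (- ((1 + h) `^ a - 1 - a * h)); rewrite normrN.
have := ler_norm (- (a * h)); rewrite normrN normrM.
lra.
Qed.

(** The difference [f] of the two sides vanishes at 1, and the first-order expansion with exponent
    [a - 1] shows that its derivative has the sign of [t - 1]. The mean value theorem on either side
    of 1 concludes. *)
Lemma powR_taylor2_ge (a e : R) : 0 < a -> 0 < e ->
  exists2 del : R, 0 < del & forall h : R, `|h| <= del ->
    1 + a * h + (a * (a - 1) / 2 - e) * h ^+ 2 <= (1 + h) `^ a.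
Proof.
(* With this tolerance the error in the derivative, multiplied by [a], is absorbed by the slope
   [2 * e * u] that the loss of [e] in the quadratic term provides. *)
move=> a0 e0; have ea : 0 < 2 * e / a by rewrite divr_gt0// mulr_gt0.
have [d d0 H] := @powR_taylor1 (a - 1) (2 * e / a) ea.
exists (Num.min d (1 / 2)) => [|h]; first by rewrite lt_min d0 divr_gt0.
rewrite le_min => /andP[hd h1].
pose f (t : R) := t `^ a - (1 + a * (t - 1) + (a * (a - 1) / 2 - e) * (t - 1) ^+ 2).
pose df (t : R) := a * t `^ (a - 1) - (a + (a * (a - 1) / 2 - e) * (2 * (t - 1))).
have fd (t : R) : 0 < t -> is_derive t 1 f (df t).
  move=> t0; have dp := @is_derive1_powR R a t t0.
  have d1 : is_derive t 1 (id - cst 1 : R -> R) 1.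
    have := is_deriveB (is_derive_id t (1 : R)) (is_derive_cst (1 : R) t 1).
    by rewrite subr0.
  have d2 := is_deriveX 2 d1.
  have d3 := is_deriveB dp (is_deriveD (is_deriveD (is_derive_cst (1 : R) t 1)
    (is_deriveZ a d1)) (is_deriveZ (a * (a - 1) / 2 - e) d2)).
  apply: (is_derive_eq d3).
  rewrite /df /GRing.scale/= (_ : (id - cst 1) t = t - 1)// expr1.
  set k := _ / 2 - e; ring.
have fc (u v : R) : 0 < u -> {within `[u, v], continuous f}.
  move=> u0; apply: derivable_within_continuous => t.
  rewrite in_itv/= => /andP[ut _].
  by have [] := fd t (lt_le_trans u0 ut).
have f1 : f 1 = 0 by rewrite /f powR1 subrr; ring.
have dfs (t : R) : `|t - 1| <= d -> 0 <= df t * (t - 1).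
  move=> td; have := H _ td; rewrite subrKC => Ht.
  set u := t - 1 in Ht *.
  have -> : df t * u = a * ((t `^ (a - 1) - 1 - (a - 1) * u) * u) + 2 * e * u ^+ 2.
    by rewrite /df -/u; field.
  have : `|(t `^ (a - 1) - 1 - (a - 1) * u) * u| <= 2 * e / a * u ^+ 2.
    by rewrite normrM -real_normK ?num_real// expr2 mulrA ler_wpM2r.
  move=> /(ler_wpM2l (ltW a0)).
  have -> : a * (2 * e / a * u ^+ 2) = 2 * e * u ^+ 2.
    by field; rewrite gt_eqF.
  have := ler_norm (- ((t `^ (a - 1) - 1 - (a - 1) * u) * u)); rewrite normrN.
  by move=> /(ler_wpM2l (ltW a0)); lra.
rewrite -subr_ge0 (_ : _ - _ = f (1 + h)); last first.
  by rewrite /f (_ : 1 + h - 1 = h)//; ring.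
move: h1; rewrite ler_norml => /andP[h1 h2].
have [h0|h0|->] := ltgtP h 0; last by rewrite addr0 f1.
- have [|||c] := @MVT _ f df (1 + h) 1.
  + by lra.
  + by move=> t; rewrite in_itv/= => /andP[t1 _]; apply: fd; lra.
  + by apply: fc; lra.
  rewrite in_itv/= f1 => /andP[c1 c2] E.
  have : 0 <= df c * (c - 1).
    apply: dfs; rewrite ltr0_norm; last lra.
    by move: hd; rewrite ltr0_norm//; lra.
  have c0 : 1 - c > 0 by lra.
  have -> : df c * (c - 1) = - (df c) * (1 - c) by ring.
  rewrite pmulr_lge0// => dfc.
  have -> : f (1 + h) = - df c * (1 - (1 + h)) by lra.
  by rewrite mulr_ge0//; lra.
- have [|||c] := @MVT _ f df 1 (1 + h).
  + by lra.
  + by move=> t; rewrite in_itv/= => /andP[t1 _]; apply: fd; lra.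
  + by apply: fc; lra.
  rewrite in_itv/= f1 subr0 => /andP[c1 c2] ->.
  have : 0 <= df c * (c - 1).
    apply: dfs; rewrite gtr0_norm; last lra.
    by move: hd; rewrite gtr0_norm//; lra.
  rewrite pmulr_lge0; last lra.
  by move=> dfc; rewrite mulr_ge0//; lra.
Qed.

End power_bounds.

(** * Lower bound for one increment of the Lyapunov function *)

Section power_increment.
Context {R : realType}.

(** With [h = (w - x) / x], small jumps are handled by the expansions near 1. For large jumps the
    cut-off function is 0, and the term of order [p] makes the left side nonpositive. *)
Lemma powR_increment_ge (nu p e B : R) : 0 < nu -> 2 < p -> 0 < e -> 0 <= B ->
  exists (C del : R), 0 <= C /\ 0 < del <= 1 / 2 /\
  forall x w b : R, 1 <= x -> 0 <= w -> 0 <= b <= B ->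
    x `^ nu * (1 + nu / x * (w - x) + (nu * (nu - 1) / 2 - e) / x ^+ 2 * (w - x) ^+ 2
               + (1 - e) / x ^+ 2 * b - C / x `^ p * `|w - x| `^ p)
    <= if `|w - x| <= del * x then w `^ nu * (1 + b / w ^+ 2) else 0.
Proof.
move=> nu0 p2 e0 B0.
have [d1 d10 H1] := @powR_taylor2_ge R nu e nu0 e0.
have [d2 d20 H2] := @powR_near1 R (nu - 2) e e0.
pose del := Num.min (Num.min d1 d2) (1 / 2).
have del0 : 0 < del by rewrite !lt_min d10 d20 divr_gt0.
have del1 : del <= 1 / 2 by rewrite ge_min lexx orbT.
set k := nu * (nu - 1) / 2 - e.
(* The numerator sums the coefficients of the four terms to be dominated when [|h| > del]; the
   denominator normalises [|h|] by [del]. *)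
pose C := (1 + nu + `|k| + B) / del `^ p.
have C0 : 0 <= C by rewrite divr_ge0 ?powR_ge0// !addr_ge0// ltW.
exists C, del; split => //; split; first by rewrite del0.
move=> x w b x1 w0 /andP[b0 bB].
have x0 : 0 < x by lra.
have xN0 : x != 0 by rewrite gt_eqF.
set h := (w - x) / x.
have wE : w = x * (1 + h) by rewrite /h; field.
have wxE : w - x = x * h by rewrite /h; field.
have -> : nu / x * (w - x) = nu * h by rewrite wxE; field.
have -> : k / x ^+ 2 * (w - x) ^+ 2 = k * h ^+ 2 by rewrite wxE; field.
have -> : C / x `^ p * `|w - x| `^ p = C * `|h| `^ p.
  rewrite wxE normrM powRM// gtr0_norm//.
  by field; rewrite gt_eqF// powR_gt0.
have hp0 : 0 <= C * `|h| `^ p by rewrite mulr_ge0// powR_ge0.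
have -> : (`|w - x| <= del * x) = (`|h| <= del).
  by rewrite wxE normrM gtr0_norm// mulrC ler_pM2r.
have x2 : 1 <= x ^+ 2 by rewrite exprn_ege1.
case: ifPn => hd; last rewrite -ltNge in hd.
- have [h1 h2] : `|h| <= d1 /\ `|h| <= d2.
    by move: hd; rewrite !le_min => /andP[/andP[? ?] _].
  have h0 : 0 < 1 + h.
    have : `|h| <= 1 / 2 by rewrite (le_trans hd).
    by rewrite ler_norml => /andP[? _]; lra.
  have := H1 _ h1; rewrite -/k => A1; have A2 := H2 _ h2.
  rewrite wE powRM ?(ltW x0) ?(ltW h0)// -[leRHS]mulrA.
  rewrite ler_pM2l ?powR_gt0// mulrDr mulr1.
  have -> : (1 + h) `^ nu * (b / (x * (1 + h)) ^+ 2) =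
            b / x ^+ 2 * (1 + h) `^ (nu - 2).
    rewrite powRB; last by apply/implyP => _; rewrite gt_eqF.
    by rewrite powR_mulrn ?ltW//; field; rewrite xN0 gt_eqF.
  have -> : (1 - e) / x ^+ 2 * b = b / x ^+ 2 * (1 - e) by ring.
  have := ler_wpM2l (_ : 0 <= b / x ^+ 2) A2.
  by rewrite divr_ge0 ?sqr_ge0// => /(_ isT); lra.
(* Large jump: [u = |h| / del] is at least 1, so [1], [u] and [u^2] are all at most [u^p], as
   [p > 2]. *)
- rewrite pmulr_rle0 ?powR_gt0// subr_le0.
  pose u : R := `|h| / del.
  have hE : `|h| = u * del by rewrite /u mulfVK// gt_eqF.
  have u1 : 1 <= u by rewrite ler_pdivlMr// mul1r ltW.
  have u0 : 0 <= u by lra.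
  have -> : C * `|h| `^ p = (1 + nu + `|k| + B) * u `^ p.
    rewrite hE powRM ?(ltW del0)// /C.
    by field; rewrite gt_eqF// powR_gt0.
  have up1 : 1 <= u `^ p by rewrite -(powRr0 u) ler_powR//; lra.
  have upu : u <= u `^ p by rewrite le1r_powR//; lra.
  have upu2 : u ^+ 2 <= u `^ p by rewrite -powR_mulrn// ler_powR//; lra.
  have hu : `|h| <= u by rewrite hE ler_piMr//; lra.
  have a1 : nu * h <= nu * u `^ p.
    by rewrite ler_pM2l// (le_trans (ler_norm _))// (le_trans hu).
  have a2 : k * h ^+ 2 <= `|k| * u `^ p.
    rewrite (le_trans (ler_norm _))// normrM ler_wpM2l//.
    rewrite normrX (le_trans _ upu2)// lerXn2r// nnegrE//.
  have a3 : (1 - e) / x ^+ 2 * b <= B * u `^ p.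
    have b1 : b / x ^+ 2 <= b by rewrite ler_pdivrMr ?ler_peMr//; lra.
    have b2 : 0 <= b / x ^+ 2 by rewrite divr_ge0// sqr_ge0.
    have -> : (1 - e) / x ^+ 2 * b = b / x ^+ 2 - e * (b / x ^+ 2) by ring.
    have := mulr_ge0 (ltW e0) b2.
    have := ler_wpM2l B0 up1; lra.
  by rewrite !(mulrDl _ _ (u `^ p)) mul1r; do 3?[apply: lerD => //].
Qed.

End power_increment.

Lemma uniform_threshold {R : realType} {I : finType} (P : I -> R -> Prop) :
  (forall i, exists M, forall x, M < x -> P i x) ->
  exists M, forall i x, M < x -> P i x.
Proof.
move=> /choice[M HM]; exists (\sum_i `|M i|) => i x Mx.
apply: HM; apply: le_lt_trans Mx; apply: le_trans (ler_norm _) _.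
by rewrite (bigD1 i)//= lerDl sumr_ge0.
Qed.

(** * One-step moments of the kernel and the Lyapunov drift *)

Section one_step.
Local Set Implicit Arguments.
Local Unset Strict Implicit.
Context {R : realType} {S : finType}.
Variables (Sig : set (R * S)) (K : R * S -> R * S -> R).
Hypothesis HK : stochastic_kernel Sig K.
Variables (p Cp : R) (Hp : 2 < p).
Hypothesis Hmom : forall z, Sig z -> (pmoment Sig K p z <= Cp%:E)%E.
Implicit Types (z w : R * S) (f : R * S -> R).

Local Notation E z := (wmean Sig (K z)).
Local Notation summable z := (wsummable Sig (K z)).

Let K0 z w : 0 <= K z w. Proof. by case: HK => H _; exact: H. Qed.

Lemma kernel_wsum1 z : Sig z -> wsum Sig (K z) (fun=> 1) = 1%E.
Proof.
case: HK => _ [_ H] /H <-.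
by apply: eq_esum => w _; rewrite mulr1.
Qed.

Lemma kernel_summable_cst z a : Sig z -> summable z (fun=> a).
Proof.
move=> zS; rewrite -[a]mulr1; apply: wsummableZ => //.
by rewrite /wsummable normr1 kernel_wsum1// ltry.
Qed.

Lemma kernel_summable_bounded z f a : Sig z ->
  (forall w, Sig w -> `|f w| <= a) -> summable z f.
Proof.
move=> zS fa; apply: (@wsummable_le _ _ _ _ (K0 z) _ (fun=> a)).
  by move=> w Sw; rewrite (le_trans (fa _ Sw))// ler_norm.
exact: kernel_summable_cst.
Qed.

Lemma kernel_mean_cst z a : Sig z -> E z (fun=> a) = a.
Proof.
move=> zS; rewrite -[in LHS](mulr1 a) wmeanZ//; last exact: kernel_summable_cst.
rewrite wmean_ge0E//; last exact: kernel_summable_cst.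
by rewrite kernel_wsum1// mulr1.
Qed.

Lemma kernel_summable_pow z : Sig z -> summable z (fun w => `|w.1 - z.1| `^ p).
Proof.
move=> zS; apply: le_lt_trans (le_trans _ (Hmom zS)) (ltry Cp).
by apply: le_esum => w _; rewrite norm_powR ?normr_id.
Qed.

Lemma kernel_mean_pow_le z : Sig z -> E z (fun w => `|w.1 - z.1| `^ p) <= Cp.
Proof.
move=> zS; have s := kernel_summable_pow zS.
rewrite wmean_ge0E//.
rewrite -lee_fin fineK; last by apply: wsum_fin => // w _; exact: powR_ge0.
exact: Hmom.
Qed.

Lemma kernel_summable_le z f a b : Sig z ->
  (forall w, Sig w -> `|f w| <= a + b * `|w.1 - z.1| `^ p) -> summable z f.
Proof.
move=> zS fab.
apply: (@wsummable_le _ _ _ _ (K0 z) _ (fun w => a + b * `|w.1 - z.1| `^ p)).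
  by move=> w Sw; rewrite (le_trans (fab _ Sw))// ler_norm.
apply: wsummableD => //; first exact: kernel_summable_cst.
by apply: wsummableZ => //; exact: kernel_summable_pow.
Qed.

(** As [p > 2], this makes the increment and its square summable from the moment bound of order
    [p]. *)
Lemma normX_le_1Dpow (x : R) (n : nat) : (n <= 2)%N -> `|x| ^+ n <= 1 + `|x| `^ p.
Proof.
move=> n2; have [x1|x1] := leP `|x| 1.
  by apply: (@le_trans _ _ 1); [exact: exprn_ile1|rewrite lerDl powR_ge0].
rewrite (@le_trans _ _ (`|x| `^ p)) ?lerDr//.
rewrite -powR_mulrn// ler_powR ?(ltW x1)//.
by rewrite (le_trans _ (ltW Hp))// ler_nat.
Qed.

Lemma kernel_summable_increment z : Sig z -> summable z (fun w => w.1 - z.1).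
Proof.
move=> zS; apply: (@kernel_summable_le _ _ 1 1) => // w _.
by rewrite mul1r -[leLHS]expr1 normX_le_1Dpow.
Qed.

Lemma kernel_summable_increment2 z : Sig z -> summable z (fun w => (w.1 - z.1) ^+ 2).
Proof.
move=> zS; apply: (@kernel_summable_le _ _ 1 1) => // w _.
by rewrite mul1r normrX normX_le_1Dpow.
Qed.

Lemma kernel_mean_increment x i : E (x, i) (fun w => w.1 - x) = mux Sig K i x.
Proof.
rewrite /wmean /mux; congr (_ - fine _).
by apply: eq_wsum => w _; rewrite opprB.
Qed.

Lemma kernel_mean_increment2 x i : Sig (x, i) ->
  E (x, i) (fun w => (w.1 - x) ^+ 2) = sigma2x Sig K i x.
Proof.
move=> zS; rewrite wmean_ge0E//; last exact: kernel_summable_increment2.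
by move=> w _; rewrite sqr_ge0.
Qed.

Lemma kernel_mean_fiber x i j : Sig (x, i) ->
  E (x, i) (fun w => (w.2 == j)%:R) = qx Sig K i j x.
Proof.
move=> zS; rewrite wmean_ge0E//; last first.
  apply: (@kernel_summable_bounded _ _ 1) => // w _.
  by rewrite normr_nat lern1 leq_b1.
rewrite /qx esum_mkcondr; congr fine; apply: eq_esum => w _.
case: ifPn => [/set_mem/= ->|]; first by rewrite eqxx mulr1.
by move=> /negP e; case: eqP => [wj|_]; [case: e; rewrite inE|rewrite mulr0].
Qed.

Lemma kernel_mean_line x i (b : S -> R) : Sig (x, i) ->
  E (x, i) (fun w => b w.2) = \sum_j b j * qx Sig K i j x.
Proof.
move=> zS; have sfib j : summable (x, i) (fun w => b j * (w.2 == j)%:R).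
  apply: wsummableZ => //; apply: (@kernel_summable_bounded _ _ 1) => // w _.
  by rewrite normr_nat lern1 leq_b1.
have -> : (fun w : R * S => b w.2) = (fun w => \sum_j b j * (w.2 == j)%:R).
  apply/funext => w; rewrite (bigD1 w.2)//= eqxx mulr1 big1 ?addr0// => j.
  by rewrite eq_sym => /negbTE ->; rewrite mulr0.
(* Induction over an arbitrary list of lines, carrying summability along because [wmeanD] requires
   it. *)
suff H (s : seq S) : summable (x, i) (fun w => \sum_(j <- s) b j * (w.2 == j)%:R) /\
    E (x, i) (fun w => \sum_(j <- s) b j * (w.2 == j)%:R) =
    \sum_(j <- s) b j * qx Sig K i j x by case: (H (index_enum S)).
elim: s => [|j s [IH1 IH2]].
  under [X in wsummable _ _ X]eq_fun do rewrite big_nil.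
  under [X in wmean _ _ X]eq_fun do rewrite big_nil.
  by split; [exact: kernel_summable_cst|rewrite kernel_mean_cst// big_nil].
under [X in wsummable _ _ X]eq_fun do rewrite big_cons.
under [X in wmean _ _ X]eq_fun do rewrite big_cons.
split; first exact: wsummableD.
rewrite wmeanD// big_cons IH2 wmeanZ//; first by rewrite kernel_mean_fiber.
apply: (@kernel_summable_bounded _ _ 1) => // w _.
by rewrite normr_nat lern1 leq_b1.
Qed.

Lemma qx_le1 x i j : Sig (x, i) -> qx Sig K i j x <= 1.
Proof.
move=> zS; rewrite -kernel_mean_fiber// -[leRHS](@kernel_mean_cst _ 1 zS).
apply: ler_wmean => //.
- apply: (@kernel_summable_bounded _ _ 1) => // w _.
  by rewrite normr_nat lern1 leq_b1.
- exact: kernel_summable_cst.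
- by move=> w _; rewrite lern1 leq_b1.
Qed.

(** Averaging [powR_increment_ge] over one step, the coefficient of [x^-2] tends to [b i + D],
    whereas [b i] suffices; the margin [D] absorbs all errors at high levels. The moment term is of
    order [x^-p], hence negligible against [x^-2]. *)
Lemma lyapunov_drift (Q : S -> S -> R) (c s2 b : S -> R) (nu D : R) :
  (forall z, Sig z -> 0 <= z.1) ->
  (forall (i j : S) (eps : R), 0 < eps -> exists M : R, forall x : R,
      M < x -> Sig (x, i) -> `|qx Sig K i j x - Q i j| < eps) ->
  (forall i, 0 <= s2 i) ->
  (forall (i : S) (eps : R), 0 < eps -> exists M : R, forall x : R,
      M < x -> Sig (x, i) -> `|mux Sig K i x - c i / x| <= eps / x) ->
  (forall (i : S) (eps : R), 0 < eps -> exists M : R, forall x : R,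
      M < x -> Sig (x, i) -> `|sigma2x Sig K i x - s2 i| <= eps) ->
  0 < nu -> (forall i, 0 <= b i) -> 0 < D ->
  (forall i, nu * c i + nu * (nu - 1) / 2 * s2 i + (\sum_j b j * Q i j - b i) = D) ->
  exists (x0 del : R), 1 <= x0 /\ 0 < del <= 1 / 2 /\
    forall x i, x0 < x -> Sig (x, i) ->
      x `^ nu * (1 + b i / x ^+ 2) <=
      E (x, i) (fun w => if `|w.1 - x| <= del * x
                         then w.1 `^ nu * (1 + b w.2 / w.1 ^+ 2) else 0).
Proof.
move=> Spos Hq s20 Hmu Hsig nu0 b0 D0 HD.
pose B := \sum_j b j; pose s := \sum_j s2 j; pose kap := nu * (nu - 1) / 2.
have bB i : b i <= B by rewrite /B (bigD1 i)//= lerDl sumr_ge0.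
have ss i : s2 i <= s by rewrite /s (bigD1 i)//= lerDl sumr_ge0.
have B0 : 0 <= B by rewrite sumr_ge0.
have s0 : 0 <= s by rewrite sumr_ge0.
(* [L] collects the factors of [e] in the errors: [nu] from the mean, [|kap|] and [s + 1] from the
   second moment, [2 * B] from the line change, 1 from the moment of order [p]. *)
pose L := nu + `|kap| + s + 1 + 2 * B + 1.
have L0 : 0 < L by rewrite /L; have := normr_ge0 kap; lra.
pose e := Num.min 1 (D / L).
have e0 : 0 < e by rewrite lt_min ltr01 divr_gt0.
have e1 : e <= 1 by rewrite ge_min lexx.
have eL : e * L <= D by rewrite -ler_pdivlMr// ge_min lexx orbT.
have [C [del [C0 [hdel H]]]] := @powR_increment_ge R _ _ _ _ nu0 Hp e0 B0.
have [Mq HMq] : exists M : R, forall (ij : S * S) (x : R), M < x ->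
    Sig (x, ij.1) -> `|qx Sig K ij.1 ij.2 x - Q ij.1 ij.2| < e.
  by apply: uniform_threshold => -[i j]; exact: Hq.
have [Mm HMm] := uniform_threshold _ (fun i => Hmu i e e0).
have [Ms HMs] := uniform_threshold _ (fun i => Hsig i e e0).
(* Beyond [Mp] the moment term [C * |Cp| / x^(p - 2)] is at most [e]. *)
pose Mp := (1 + C * `|Cp| / e) `^ (p - 2)^-1.
pose x0 := 1 + `|Mq| + `|Mm| + `|Ms| + Mp.
have Mp0 : 0 <= Mp by exact: powR_ge0.
exists x0, del; split.
  by rewrite /x0; have := (normr_ge0 Mq, normr_ge0 Mm, normr_ge0 Ms) => -[[]]; lra.
split=> // x i x0x Si.
have [[xq xm] [xs xp]] : (Mq < x /\ Mm < x) /\ (Ms < x /\ Mp < x).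
  move: x0x; rewrite /x0; have := (ler_norm Mq, ler_norm Mm, ler_norm Ms) => -[[]].
  by have := (normr_ge0 Mq, normr_ge0 Mm, normr_ge0 Ms) => -[[]]; lra.
have x1 : 1 <= x.
  move: x0x; rewrite /x0.
  by have := (normr_ge0 Mq, normr_ge0 Mm, normr_ge0 Ms) => -[[]]; lra.
have xgt0 : 0 < x by lra.
have xN0 : x != 0 by rewrite gt_eqF.
pose F (w : R * S) := 1 + nu / x * (w.1 - x) + (kap - e) / x ^+ 2 * (w.1 - x) ^+ 2
   + (1 - e) / x ^+ 2 * b w.2 + - (C / x `^ p) * `|w.1 - x| `^ p.
have sb : summable (x, i) (fun w => b w.2).
  by apply: (@kernel_summable_bounded _ _ B) => // w _; rewrite ger0_norm.
have sd := kernel_summable_increment Si.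
have sd2 := kernel_summable_increment2 Si.
have sp := kernel_summable_pow Si.
have sc := kernel_summable_cst 1 Si.
have H0 := K0.
have s1 : summable (x, i) (fun w => 1 + nu / x * (w.1 - x)).
  by apply: wsummableD => //; exact: wsummableZ.
have s3 : summable (x, i) (fun w => 1 + nu / x * (w.1 - x)
    + (kap - e) / x ^+ 2 * (w.1 - x) ^+ 2).
  by apply: wsummableD => //; exact: wsummableZ.
have s4 : summable (x, i) (fun w => 1 + nu / x * (w.1 - x)
    + (kap - e) / x ^+ 2 * (w.1 - x) ^+ 2 + (1 - e) / x ^+ 2 * b w.2).
  by apply: wsummableD => //; exact: wsummableZ.
have s5 : summable (x, i) F.
  by apply: wsummableD => //; exact: wsummableZ.
have EF : E (x, i) F = 1 + nu / x * mux Sig K i x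
    + (kap - e) / x ^+ 2 * sigma2x Sig K i x
    + (1 - e) / x ^+ 2 * (\sum_j b j * qx Sig K i j x)
    + - (C / x `^ p) * E (x, i) (fun w => `|w.1 - x| `^ p).
  rewrite /F wmeanD//; last exact: wsummableZ.
  rewrite wmeanD//; last exact: wsummableZ.
  rewrite wmeanD//; last exact: wsummableZ.
  rewrite wmeanD//; last exact: wsummableZ.
  rewrite !wmeanZ// kernel_mean_cst// kernel_mean_increment.
  by rewrite kernel_mean_increment2// kernel_mean_line.
pose I (w : R * S) := if `|w.1 - x| <= del * x
  then w.1 `^ nu * (1 + b w.2 / w.1 ^+ 2) else 0.
have sI : summable (x, i) I.
  have [d0 d1] := andP hdel.
  apply: (@kernel_summable_bounded _ _ ((2 * x) `^ nu * (1 + B / (x / 2) ^+ 2))) => // w Sw.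
  have w0 := Spos _ Sw; rewrite /I; case: ifPn => [|_]; last first.
    by rewrite normr0 mulr_ge0 ?powR_ge0// addr_ge0// divr_ge0// sqr_ge0.
  have := ler_wpM2r (ltW xgt0) d1.
  rewrite ler_norml => h1 /andP[h2 h3].
  have wx2 : x / 2 <= w.1 by lra.
  have x20 : 0 < x / 2 by lra.
  have wgt0 : 0 < w.1 by lra.
  rewrite ger0_norm; last by rewrite mulr_ge0 ?powR_ge0// addr_ge0// divr_ge0// sqr_ge0.
  apply: ler_pM; rewrite ?powR_ge0//.
  - by rewrite addr_ge0// divr_ge0// sqr_ge0.
  - by apply: ge0_ler_powR; rewrite ?nnegrE//; lra.
  - rewrite lerD2l; apply: ler_pM => //; first by rewrite invr_ge0 sqr_ge0.
    by rewrite lef_pV2 ?posrE ?exprn_gt0// lerXn2r// nnegrE ltW.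
have step : x `^ nu * E (x, i) F <= E (x, i) I.
  rewrite -wmeanZ//; apply: ler_wmean => //; first exact: wsummableZ.
  move=> w Sw; have := H x w.1 (b w.2) x1 (Spos _ Sw).
  rewrite b0 bB => /(_ isT); apply: le_trans.
  by rewrite /F mulNr.
apply: le_trans step; rewrite ler_pM2l ?powR_gt0// EF.
set m := mux _ _ _ _; set v := sigma2x _ _ _ _; set q := \sum_j b j * qx Sig K i j x.
set P := wmean _ _ _.
have PCp : P <= `|Cp|.
  by rewrite (le_trans (kernel_mean_pow_le Si))// ler_norm.
have xpE : x `^ p = x ^+ 2 * x `^ (p - 2).
  by rewrite -powR_mulrn ?(ltW xgt0)// -powRD ?subrKC// xN0 implybT.
have xp2 : 1 + C * `|Cp| / e <= x `^ (p - 2).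
  have p2 : 0 < p - 2 by rewrite subr_gt0.
  have -> : 1 + C * `|Cp| / e = Mp `^ (p - 2).
    rewrite /Mp -powRrM mulVf ?gt_eqF// powRr1//.
    by rewrite addr_ge0// divr_ge0 ?mulr_ge0// ltW.
  by apply: ge0_ler_powR; rewrite ?nnegrE// ltW.
have xpp : 0 < x `^ (p - 2) by exact: powR_gt0.
have A5 : C / x `^ (p - 2) * P <= e.
  apply: (@le_trans _ _ (C / x `^ (p - 2) * `|Cp|)).
    by rewrite ler_wpM2l// divr_ge0// ltW.
  rewrite mulrAC ler_pdivrMr//; apply: le_trans (ler_wpM2l (ltW e0) xp2).
  by rewrite mulrDr mulr1 mulrCA divff ?gt_eqF// mulr1; lra.
have A1 : c i - e <= x * m.
  have := HMm i x xm Si; rewrite -/m ler_norml => /andP[+ _].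
  move=> /(ler_wpM2l (ltW xgt0)).
  have -> : x * - (e / x) = - e by field.
  have -> : x * (m - c i / x) = x * m - c i by field.
  lra.
have [A2 A2'] : - e <= v - s2 i /\ v - s2 i <= e.
  by have := HMs i x xs Si; rewrite -/v ler_norml => /andP.
have A3 : \sum_j b j * Q i j - e * B <= q.
  rewrite /B mulr_sumr -sumrB; apply: ler_sum => j _.
  have := HMq (i, j) x xq Si; rewrite /= => /ltW; rewrite ler_norml => /andP[+ _].
  by move=> /(ler_wpM2l (b0 j)); lra.
have A4 : q <= B.
  apply: ler_sum => j _; rewrite -[leRHS]mulr1 ler_wpM2l//.
  exact: qx_le1.
have kv : - (`|kap| * e) <= kap * (v - s2 i).
  have : `|kap * (v - s2 i)| <= `|kap| * e.
    by rewrite normrM ler_wpM2l// ler_norml A2.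
  by rewrite ler_norml => /andP[].
have ev : e * v <= e * (s + 1).
  by rewrite ler_pM2l//; have := ss i; lra.
have eq : e * q <= e * B by rewrite ler_pM2l.
have nxm : nu * (c i - e) <= nu * (x * m) by rewrite ler_pM2l.
have fin : b i <= nu * (x * m) + (kap - e) * v + (1 - e) * q - C / x `^ (p - 2) * P.
  have := HD i; rewrite -/kap => HDi; move: eL; rewrite /L; lra.
have -> : 1 + nu / x * m + (kap - e) / x ^+ 2 * v + (1 - e) / x ^+ 2 * q
    + - (C / x `^ p) * P = 1 + (nu * (x * m) + (kap - e) * v + (1 - e) * q
      - C / x `^ (p - 2) * P) / x ^+ 2.
  by rewrite xpE; field; rewrite xN0 gt_eqF.
by rewrite lerD2l ler_wpM2r// invr_ge0 sqr_ge0.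
Qed.

End one_step.

(** * Survival probabilities and slow return from high levels *)

Section survival.
Context {R : realType} {S : finType}.
Local Set Implicit Arguments.
Local Unset Strict Implicit.
Variables (Sig : set (R * S)) (K : R * S -> R * S -> R).
Hypothesis Spos : forall z, Sig z -> 0 <= z.1.
Hypothesis HK : stochastic_kernel Sig K.
Implicit Types (z w : R * S) (f : R * S -> R).

(* [survival l n z] is the probability that the chain started at [z] stays
   above level [l] at the times [0, ..., n]. *)
Fixpoint survival (l : R) (n : nat) (z : R * S) : R :=
  (l < z.1)%R%:R *
  (if n is m.+1 then fine (wsum Sig (K z) (survival l m)) else 1).

Let K0 z w : 0 <= K z w. Proof. by case: HK => H _; exact: H. Qed.

Let fine_wsum_le z f : Sig z -> (forall w, Sig w -> 0 <= f w <= 1) ->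
  0 <= fine (wsum Sig (K z) f) <= 1.
Proof.
move=> zS f01.
have f0 : (0 <= wsum Sig (K z) f)%E by apply: wsum_ge0 => // w /f01/andP[].
have f1 : (wsum Sig (K z) f <= 1)%E.
  by rewrite -(kernel_wsum1 HK zS); apply: le_wsum => // w /f01/andP[].
rewrite fine_ge0//= -lee_fin fineK// ge0_fin_numE//.
by rewrite (le_lt_trans f1)// ltry.
Qed.

Lemma survival01 l n z : Sig z -> 0 <= survival l n z <= 1.
Proof.
elim: n z => [|n IH] z zS /=; first by rewrite mulr1 ler0n lern1 leq_b1.
have /andP[h0 h1] := fine_wsum_le zS IH.
by case: ltP => _; rewrite ?mul0r ?mul1r ?h0 ?lexx ?ler01.
Qed.

Lemma survival_le1 l n z : Sig z -> survival l n z <= 1.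
Proof. by move=> /(survival01 l n)/andP[]. Qed.

Lemma survival_ge0 l n z : 0 <= survival l n z.
Proof.
elim: n z => [|n IH] z /=; rewrite mulr_ge0 ?ler0n//.
by apply/fine_ge0/wsum_ge0 => // w _; exact: IH.
Qed.

Lemma survival_summable l n z : Sig z -> wsummable Sig (K z) (survival l n).
Proof.
move=> zS; apply: (@kernel_summable_bounded _ _ _ _ HK _ _ 1) => // w Sw.
by rewrite ger0_norm ?survival_le1 ?survival_ge0.
Qed.

Lemma survivalS l n z : Sig z -> l < z.1 ->
  survival l n.+1 z = wmean Sig (K z) (survival l n).
Proof.
move=> zS lz; rewrite /= lz mul1r wmean_ge0E//; last exact: survival_summable.
by move=> w _; exact: survival_ge0.
Qed.

Lemma survival_nincr l n z : Sig z -> survival l n.+1 z <= survival l n z.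
Proof.
elim: n z => [|n IH] z zS.
  have /andP[_ h] := fine_wsum_le zS (@survival01 l 0).
  by rewrite [leRHS]/= [leLHS]/= ler_wpM2l// ler0n.
have [lz|zl] := ltP l z.1; last by rewrite /= ltNge zl !mul0r.
rewrite !survivalS//; apply: ler_wmean => //; exact: survival_summable.
Qed.

Variables (p Cp : R) (Hp : 2 < p).
Hypothesis Hmom : forall z, Sig z -> (pmoment Sig K p z <= Cp%:E)%E.

(* The quadratic test function [4 (1 - w/y)_+^2] is at least 1 below [y/2] and
   vanishes above [y]; above [y/2] it grows by at most [A/y^2] per step on average. *)
Definition escape_barrier (y : R) w : R := 4 * Num.max (1 - w.1 / y) 0 ^+ 2.

Lemma escape_barrier_ge1 y z : 0 < y -> z.1 <= y / 2 -> 1 <= escape_barrier y z.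
Proof.
move=> y0 zy; rewrite /escape_barrier.
have h : 1 / 2 <= 1 - z.1 / y.
  have : z.1 / y <= 1 / 2 by rewrite ler_pdivrMr//; lra.
  lra.
rewrite max_l; last lra.
have : (1 / 2) ^+ 2 <= (1 - z.1 / y) ^+ 2 by rewrite lerXn2r ?nnegrE//; lra.
lra.
Qed.

Lemma escape_barrier_eq0 y z : 0 < y -> y <= z.1 -> escape_barrier y z = 0.
Proof.
move=> y0 yz; rewrite /escape_barrier max_r ?expr0n ?mulr0//.
by rewrite subr_le0 ler_pdivlMr// mul1r.
Qed.

Lemma escape_barrier_summable y z : 0 < y -> Sig z ->
  wsummable Sig (K z) (escape_barrier y).
Proof.
move=> y0 zS; apply: (@kernel_summable_bounded _ _ _ _ HK _ _ 4) => // w Sw.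
rewrite /escape_barrier ger0_norm; last by rewrite mulr_ge0// sqr_ge0.
rewrite -[leRHS]mulr1 ler_pM2l// exprn_ile1//.
  by rewrite le_max lexx orbT.
by rewrite ge_max ler01 andbT gerBl divr_ge0 ?Spos// ltW.
Qed.

(** The right side is the perfect square [(max a 0 - d)^2]. This quadratic majorant lets the barrier
    be averaged using only the first two moments of the increment. *)
Lemma max0_sub_sqr_le (a d : R) :
  Num.max (a - d) 0 ^+ 2 <= Num.max a 0 ^+ 2 - 2 * Num.max a 0 * d + d ^+ 2.
Proof.
have -> : Num.max a 0 ^+ 2 - 2 * Num.max a 0 * d + d ^+ 2 = (Num.max a 0 - d) ^+ 2.
  by ring.
have [ad|ad] := leP (a - d) 0; first by rewrite expr0n/= sqr_ge0.
have aa : a <= Num.max a 0 by rewrite le_max lexx.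
by rewrite lerXn2r ?nnegrE//; lra.
Qed.

(** The majorant is used with [a = 1 - x / y] and [d = (w - x) / y]. Since [x > y / 2], the drift is
    at most [2 * M / y], so the linear and quadratic terms are both of order [y^-2]. *)
Lemma escape_barrier_step (M V y : R) x i : 0 < y -> y / 2 < x -> Sig (x, i) ->
  `|mux Sig K i x| <= M / x -> sigma2x Sig K i x <= V ->
  wmean Sig (K (x, i)) (escape_barrier y) <=
    escape_barrier y (x, i) + 4 * (4 * M + V) / y ^+ 2.
Proof.
move=> y0 yx Si hm hv; set m := Num.max (1 - x / y) 0.
have x0 : 0 < x by lra.
have m0 : 0 <= m by rewrite le_max lexx orbT.
have m1 : m <= 1.
  by rewrite ge_max ler01 andbT gerBl divr_ge0// ltW.
have sd := kernel_summable_increment HK Hp Hmom Si.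
have sd2 := kernel_summable_increment2 HK Hp Hmom Si.
have sc := kernel_summable_cst HK (4 * m ^+ 2) Si.
pose F (w : R * S) := 4 * m ^+ 2 + - (8 * m / y) * (w.1 - x) + 4 / y ^+ 2 * (w.1 - x) ^+ 2.
have H0 := K0.
have s1 : wsummable Sig (K (x, i)) (fun w => 4 * m ^+ 2 + - (8 * m / y) * (w.1 - x)).
  by apply: wsummableD => //; exact: wsummableZ.
have s2 : wsummable Sig (K (x, i)) F by apply: wsummableD => //; exact: wsummableZ.
have EF : wmean Sig (K (x, i)) F = 4 * m ^+ 2 + - (8 * m / y) * mux Sig K i x
    + 4 / y ^+ 2 * sigma2x Sig K i x.
  rewrite /F wmeanD//; last exact: wsummableZ.
  rewrite wmeanD//; last exact: wsummableZ.
  rewrite (kernel_mean_cst HK _ Si) !wmeanZ// kernel_mean_increment.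
  by rewrite (kernel_mean_increment2 HK Hp Hmom).
apply: (@le_trans _ _ (wmean Sig (K (x, i)) F)).
  apply: ler_wmean => //; first exact: escape_barrier_summable.
  move=> w Sw; rewrite /escape_barrier /F mulNr.
  have -> : 1 - w.1 / y = 1 - x / y - (w.1 - x) / y by ring.
  have := max0_sub_sqr_le (1 - x / y) ((w.1 - x) / y); rewrite -/m.
  have -> : 8 * m / y * (w.1 - x) = 4 * (2 * m * ((w.1 - x) / y)) by ring.
  have -> : 4 / y ^+ 2 * (w.1 - x) ^+ 2 = 4 * ((w.1 - x) / y) ^+ 2.
    by field; rewrite gt_eqF.
  by lra.
rewrite EF {1}/escape_barrier/= -/m -addrA lerD2l.
have -> : 4 * (4 * M + V) / y ^+ 2 = 4 * (4 * M) / y ^+ 2 + 4 * V / y ^+ 2 by ring.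
have y2 : 0 < y ^+ 2 by rewrite exprn_gt0.
apply: lerD; last by rewrite mulrAC ler_pM2r ?invr_gt0// ler_pM2l.
have M0 : 0 <= M.
  by have := le_trans (normr_ge0 _) hm; rewrite pmulr_lge0 ?invr_gt0.
have hmy : `|mux Sig K i x| <= 2 * M / y.
  rewrite (le_trans hm)// ler_pdivrMr// mulrAC ler_pdivlMr//.
  have : y * M <= 2 * x * M by rewrite ler_wpM2r//; lra.
  lra.
have k8 : 0 <= 8 * m / y by rewrite divr_ge0 ?mulr_ge0// ltW.
rewrite (le_trans (ler_norm _))// normrM normrN (ger0_norm k8).
apply: le_trans (ler_wpM2l k8 hmy) _.
have -> : 8 * m / y * (2 * M / y) = m * (4 * (4 * M) / y ^+ 2).
  by field; rewrite gt_eqF.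
by rewrite ler_piMl// divr_ge0 ?mulr_ge0// ltW.
Qed.

(** Supermartingale estimate by induction on [n]: at or below [y / 2] the barrier is at least 1 and
    the bound is trivial; above it, averaging the induction hypothesis over one step adds at most
    [A / y^2]. *)
Lemma survival_escape (l A y : R) n z : 0 < y -> l <= y / 2 -> 0 <= A ->
  (forall z, Sig z -> y / 2 < z.1 ->
    wmean Sig (K z) (escape_barrier y) <= escape_barrier y z + A / y ^+ 2) ->
  Sig z -> 1 - survival l n z <= escape_barrier y z + n%:R * (A / y ^+ 2).
Proof.
move=> y0 ly A0 step; have Ay : 0 <= A / y ^+ 2 by rewrite divr_ge0// sqr_ge0.
have e0 w : 0 <= escape_barrier y w by rewrite mulr_ge0// sqr_ge0.
elim: n z => [|n IH] z zS.
  have [zy|yz] := leP z.1 (y / 2).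
    have := escape_barrier_ge1 y0 zy; have := survival_ge0 l 0 z; lra.
  by rewrite /= (le_lt_trans ly yz) mulr1 subrr mul0r addr0.
have nA : 0 <= n.+1%:R * (A / y ^+ 2) by rewrite mulr_ge0.
have [zy|yz] := leP z.1 (y / 2).
  have := escape_barrier_ge1 y0 zy; have := survival_ge0 l n.+1 z; lra.
rewrite survivalS//; last exact: le_lt_trans ly yz.
have H0 := K0; have sS := survival_summable l n zS.
have sb := escape_barrier_summable y0 zS.
have sN : wsummable Sig (K z) (fun w => - survival l n w) by exact: wsummableN.
have sc a := kernel_summable_cst HK a zS.
have : wmean Sig (K z) (fun w => 1 + - survival l n w) <=
       wmean Sig (K z) (fun w => escape_barrier y w + n%:R * (A / y ^+ 2)).
  apply: ler_wmean => //; [exact: wsummableD|exact: wsummableD].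
rewrite !wmeanD// wmeanN !(kernel_mean_cst HK _ zS) => h.
by have := step _ zS yz; rewrite -natr1 mulrDl mul1r; lra.
Qed.

End survival.

(** * Reaching a high level before returning to a low one *)

Section survival_lower_bound.
Context {R : realType} {S : finType}.
Local Set Implicit Arguments.
Local Unset Strict Implicit.
Variables (Sig : set (R * S)) (K : R * S -> R * S -> R).
Hypothesis Spos : forall z, Sig z -> 0 <= z.1.
Hypothesis HK : stochastic_kernel Sig K.

(* With [G] the Lyapunov function cut off outside [l/2, 2y], the inequality
   [G <= a + C (2y)^nu survival] propagates from [n] to [n+1] by the drift
   below [y], and holds above [y] because escape to [l] takes too long. *)
Lemma survival_ge_power (b : S -> R) (B nu l del A y : R) (N : nat) z :
  0 < nu -> (forall i, 0 <= b i <= B) -> 1 <= l -> del <= 1 / 2 ->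
  (forall x i, l < x -> Sig (x, i) -> x `^ nu * (1 + b i / x ^+ 2) <=
    wmean Sig (K (x, i)) (fun w => if `|w.1 - x| <= del * x
                       then w.1 `^ nu * (1 + b w.2 / w.1 ^+ 2) else 0)) ->
  2 * l <= y -> 0 <= A -> N%:R * (A / y ^+ 2) <= 1 / 2 ->
  (forall z, Sig z -> y / 2 < z.1 ->
    wmean Sig (K z) (escape_barrier y) <= escape_barrier y z + A / y ^+ 2) ->
  Sig z -> (1 + 4 * B) * l `^ nu + 1 <= z.1 `^ nu -> z.1 <= y ->
  1 <= 2 * (1 + 4 * B) * (2 * y) `^ nu * survival Sig K l N z.
Proof.
move=> nu0 bB l1 del1 drift ly A0 NA step zS zl zy.
have K0 z' w : 0 <= K z' w by case: HK => H _; exact: H.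
have b0 i : 0 <= b i by case/andP: (bB i).
have B0 : 0 <= B by case/andP: (bB z.2) => ? ?; lra.
have y0 : 0 < y by lra.
pose F (w : R * S) := w.1 `^ nu * (1 + b w.2 / w.1 ^+ 2).
pose G (w : R * S) := if (l / 2 <= w.1) && (w.1 <= 2 * y) then F w else 0.
have F0 w : 0 <= F w by rewrite mulr_ge0 ?powR_ge0// addr_ge0// divr_ge0// sqr_ge0.
have G0 w : 0 <= G w by rewrite /G; case: ifPn.
(* Here [w.1 >= l / 2 >= 1 / 2], so [1 / w.1^2 <= 4]; this is the origin of the factor
   [1 + 4 * B]. *)
have FT w t : l / 2 <= w.1 -> w.1 <= t -> F w <= (1 + 4 * B) * t `^ nu.
  move=> lw wt; rewrite [leRHS]mulrC; apply: ler_pM; rewrite ?powR_ge0//.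
  - by rewrite addr_ge0// divr_ge0// sqr_ge0.
  - by apply: ge0_ler_powR; rewrite ?nnegrE; lra.
  - rewrite lerD2l ler_pdivrMr; last by rewrite exprn_gt0//; lra.
    have w2 : (1 / 2) ^+ 2 <= w.1 ^+ 2 by rewrite lerXn2r ?nnegrE//; lra.
    have := ler_wpM2l (mulr_ge0 (ler0n R 4) B0) w2.
    by have /andP[_] := bB w.2; lra.
set T := (1 + 4 * B) * (2 * y) `^ nu.
have T0 : 0 <= T by rewrite mulr_ge0 ?powR_ge0//; lra.
have GT w : G w <= T.
  by rewrite /G; case: ifPn => // /andP[lw wy]; exact: FT.
have Gsum z' : Sig z' -> wsummable Sig (K z') G.
  move=> Sz'; apply: (@kernel_summable_bounded _ _ _ _ HK _ _ T) => // w _.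
  by rewrite ger0_norm.
set a := (1 + 4 * B) * l `^ nu in zl.
have a0 : 0 <= a by rewrite mulr_ge0 ?powR_ge0//; lra.
have main n z' : (n <= N)%N -> Sig z' -> G z' <= a + 2 * T * survival Sig K l n z'.
  have TS m w : Sig w -> 0 <= 2 * T * survival Sig K l m w.
    by move=> _; exact: mulr_ge0 (mulr_ge0 (ler0n R 2) T0) (survival_ge0 HK l m w).
  elim: n z' => [|n IH] [x i] nN Sx.
  - rewrite /=; have [lx|xl] := ltP l x.
      by rewrite !mulr1; have := GT (x, i); lra.
    rewrite mulr1 mulr0 addr0 /G; case: ifPn => //= /andP[lx _]; exact: FT.
  - have [xl|lx] := leP x l.
      have := TS n.+1 _ Sx; rewrite /G; case: ifPn => [/andP[/= lx _]|_]; last lra.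
      by have := FT (x, i) l lx xl; rewrite -/a; lra.
    (* At or above [y] the barrier vanishes and [n + 1 <= N] steps cost at most 1/2. Survival thus
       has probability at least 1/2, and [2 * T] times it is at least [T], which bounds [G]. *)
    have [yx|xy] := leP y x.
      have := survival_escape Spos HK n.+1 y0 (_ : l <= y / 2) A0 step Sx.
      rewrite escape_barrier_eq0// add0r => /(_ ltac:(lra)) h.
      have nNA : n.+1%:R * (A / y ^+ 2) <= N%:R * (A / y ^+ 2).
        by rewrite ler_wpM2r ?ler_nat// divr_ge0// sqr_ge0.
      have s12 : 1 / 2 <= survival Sig K l n.+1 (x, i) by lra.
      have := ler_wpM2l T0 s12; have := GT (x, i); lra.
    have -> : G (x, i) = x `^ nu * (1 + b i / x ^+ 2).
      by rewrite /G /F /= ifT//; apply/andP; split; lra.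
    rewrite (le_trans (drift _ _ lx Sx))//.
    rewrite (survivalS HK _ Sx lx).
    have sS := survival_summable HK l n Sx.
    have sc := kernel_summable_cst HK a Sx.
    rewrite -wmeanZ// -[X in X + _](kernel_mean_cst HK a Sx) -wmeanD//;
      last exact: wsummableZ.
    (* Jumps of size at most [x / 2] from a point between [l] and [y] land in [[l/2, 2y]], where [G]
       is not cut off; hence the integrand of the drift is at most [G]. *)
    have dx : del * x <= 1 / 2 * x by rewrite ler_wpM2r//; lra.
    apply: ler_wmean => //.
    + apply: wsummable_le (Gsum _ Sx) => // w _.
      case: ifPn => [|_]; last by rewrite normr0.
      rewrite ler_norml => /andP[h1 h2].
      by rewrite /G ifT//; apply/andP; split; lra.
    + by apply: wsummableD => //; exact: wsummableZ.
    + move=> w Sw; apply: le_trans (IH w (ltnW nN) Sw).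
      case: ifPn => [|_]; last exact: G0.
      rewrite ler_norml => /andP[h1 h2].
      by rewrite /G ifT//; apply/andP; split; lra.
have lz : l < z.1.
  rewrite ltNge; apply/negP => zl'.
  have : z.1 `^ nu <= l `^ nu.
    by apply: ge0_ler_powR; rewrite ?nnegrE ?Spos//; lra.
  have := mulr_ge0 B0 (powR_ge0 l nu); move: zl; rewrite /a; lra.
(* By the choice of the starting height, [G z] exceeds [a] by at least 1, which is the 1 in the
   conclusion. *)
have Gz : z.1 `^ nu <= G z.
  rewrite /G ifT; last by apply/andP; split; lra.
  rewrite /F ler_peMr ?powR_ge0// lerDl divr_ge0// sqr_ge0//.
have := main N z (leqnn N) zS; rewrite /T; lra.
Qed.

End survival_lower_bound.

(** * Polynomial tail of the survival probability *)

Section polynomial_tail.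
Context {R : realType} {S : finType}.
Local Set Implicit Arguments.
Local Unset Strict Implicit.

(** For each [n] the level [y] is chosen with [y^2] proportional to [n + 1], so that [n] steps are
    too few to come back from it; then [(2 * y)^nu] is a constant times [(n + 1)^th]. The parameter
    [X] lets [l] be taken as high as desired. *)
Lemma survival_polynomial_tail (Sig : set (R * S)) (K : R * S -> R * S -> R)
  (p Cp : R) (Q : S -> S -> R) (pi c s2 : S -> R) (th X : R) :
  (forall z, Sig z -> 0 <= z.1) -> stochastic_kernel Sig K -> 2 < p ->
  (forall z, Sig z -> (pmoment Sig K p z <= Cp%:E)%E) ->
  irreducible_stochastic Q -> stationary_distribution Q pi ->
  (forall (i j : S) (eps : R), 0 < eps -> exists M : R, forall x : R,
      M < x -> Sig (x, i) -> `|qx Sig K i j x - Q i j| < eps) ->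
  (forall i, 0 <= s2 i) ->
  (forall (i : S) (eps : R), 0 < eps -> exists M : R, forall x : R,
      M < x -> Sig (x, i) -> `|mux Sig K i x - c i / x| <= eps / x) ->
  (forall (i : S) (eps : R), 0 < eps -> exists M : R, forall x : R,
      M < x -> Sig (x, i) -> `|sigma2x Sig K i x - s2 i| <= eps) ->
  0 < th -> 0 < \sum_i (2 * c i + (2 * th - 1) * s2 i) * pi i ->
  exists l y0 : R, X <= l /\ forall z, Sig z -> y0 < z.1 ->
    exists C : R, 0 < C /\ exists n0 : nat, forall n, (n0 <= n)%N ->
      C <= survival Sig K l n z * n.+1%:R `^ th.
Proof.
move=> Spos HK Hp Hmom HQ Hpi Hq s20 Hmu Hsig th0 Hcond.
pose nu := 2 * th; have nu0 : 0 < nu by rewrite /nu; lra.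
have [b [b0 Hb]] := @drift_corrector R S Q pi
  (fun i => nu * c i + nu * (nu - 1) / 2 * s2 i) HQ Hpi.
set D := \sum_j _ in Hb.
have D0 : 0 < D.
  (* With [nu = 2 * th], the drift [nu c + nu (nu - 1) / 2 s2] equals [th (2 c + (2 th - 1) s2)]. *)
  have -> : D = th * \sum_i (2 * c i + (2 * th - 1) * s2 i) * pi i.
    by rewrite mulr_sumr; apply: eq_bigr => i _; rewrite /nu; field.
  exact: mulr_gt0.
have Hb' i : nu * c i + nu * (nu - 1) / 2 * s2 i + (\sum_j b j * Q i j - b i) = D.
  by rewrite -(Hb i); under eq_bigr do rewrite mulrC.
have [x0 [del [x01 [/andP[_ del1] drift]]]] :=
  lyapunov_drift HK Hp Hmom Spos Hq s20 Hmu Hsig nu0 b0 D0 Hb'.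
have [Mm HMm] := @uniform_threshold R S _ (fun i => Hmu i 1 ltr01).
have [Ms HMs] := @uniform_threshold R S _ (fun i => Hsig i 1 ltr01).
pose l := x0 + `|X| + `|Mm| + `|Ms|.
have [lx0 lX lMm lMs] : [/\ x0 <= l, X <= l, Mm <= l & Ms <= l].
  have := (ler_norm X, ler_norm Mm, ler_norm Ms) => -[[]].
  have := (normr_ge0 X, normr_ge0 Mm, normr_ge0 Ms) => -[[]].
  by rewrite /l; split; lra.
have l1 : 1 <= l by lra.
pose B := \sum_i b i; pose Cm := \sum_i `|c i| + 1; pose V := \sum_i s2 i + 1.
have bB i : 0 <= b i <= B.
  by rewrite b0/= /B (bigD1 i)//= lerDl sumr_ge0.
have B0 : 0 <= B by rewrite sumr_ge0.
have Cm0 : 0 <= Cm by rewrite addr_ge0// sumr_ge0.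
have V0 : 0 <= V by rewrite addr_ge0// sumr_ge0.
pose A := 4 * (4 * Cm + V); have A0 : 0 <= A by rewrite /A; lra.
have step y : 2 * l <= y -> forall z, Sig z -> y / 2 < z.1 ->
    wmean Sig (K z) (escape_barrier y) <= escape_barrier y z + A / y ^+ 2.
  move=> ly [x i] Sx /= yx; have x_gt0 : 0 < x by lra.
  apply: (escape_barrier_step Spos HK Hp Hmom) => //; first lra.
  - have := HMm i x ltac:(lra) Sx => h.
    rewrite -[mux _ _ _ _](subrK (c i / x)) (le_trans (ler_normD _ _))//.
    have ci : `|c i| / x <= (\sum_i `|c i|) / x.
      by rewrite ler_wpM2r ?invr_ge0 ?(ltW x_gt0)// (bigD1 i)//= lerDl sumr_ge0.
    have cx : `|c i / x| = `|c i| / x by rewrite normrM normfV (gtr0_norm x_gt0).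
    by rewrite cx /Cm mulrDl; lra.
  - have := HMs i x ltac:(lra) Sx; rewrite ler_norml => /andP[_ h].
    have si : s2 i <= \sum_i s2 i by rewrite (bigD1 i)//= lerDl sumr_ge0.
    by rewrite /V; lra.
(* Exactly the height whose power [nu] is the starting bound required by [survival_ge_power]. *)
pose y0 := ((1 + 4 * B) * l `^ nu + 1) `^ nu^-1.
exists l, y0; split => // z zS zy0.
(* The part [2 * A] gives [n * A / y^2 <= 1 / 2]; the added 1 gives [y^2 >= n + 1]. *)
pose kap := 2 * A + 1.
have kap0 : 0 < kap by rewrite /kap; lra.
pose W := 2 * (1 + 4 * B) * (4 * kap) `^ th.
have W0 : 0 < W by rewrite mulr_gt0 ?powR_gt0// ?mulr_gt0//; lra.
exists W^-1; split; first by rewrite invr_gt0.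
have z0 := Spos _ zS.
(* From this rank on, [y >= 2 * l + z.1], so [y] is at least [2 * l] and also at least the starting
   height. *)
exists (Num.bound ((2 * l + z.1) ^+ 2)) => n n0n.
pose y := Num.sqrt (kap * n.+1%:R).
have kn0 : 0 <= kap * n.+1%:R by rewrite mulr_ge0// ltW.
have y2 : y ^+ 2 = kap * n.+1%:R by rewrite sqr_sqrtr.
have y_ge0 : 0 <= y by exact: sqrtr_ge0.
have ylz : 2 * l + z.1 <= y.
  rewrite -(ler_pXn2r (n := 2)) ?nnegrE//; last by lra.
  rewrite y2; apply: (@le_trans _ _ n.+1%:R); last first.
    by rewrite ler_peMl// /kap; lra.
  apply: (@le_trans _ _ (Num.bound ((2 * l + z.1) ^+ 2))%:R).
    by apply/ltW/archi_boundP; exact: sqr_ge0.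
  by rewrite ler_nat (leq_trans n0n).
have nA : n%:R * (A / y ^+ 2) <= 1 / 2.
  rewrite mulrA ler_pdivrMr; last by rewrite y2 mulr_gt0.
  rewrite y2 -[n.+1%:R]natr1 /kap; have := ler0n R n; have := mulr_ge0 (ler0n R n) A0; lra.
have ynu : (2 * y) `^ nu = (4 * kap) `^ th * n.+1%:R `^ th.
  rewrite /nu powRrM powR_mulrn; last by rewrite mulr_ge0.
  rewrite exprMn y2 -powRM//; last by rewrite mulr_ge0// ltW.
  by congr (_ `^ _); ring.
have zl : (1 + 4 * B) * l `^ nu + 1 <= z.1 `^ nu.
  have -> : (1 + 4 * B) * l `^ nu + 1 = y0 `^ nu.
    rewrite /y0 -powRrM mulVf ?gt_eqF// powRr1//.
    by rewrite addr_ge0// mulr_ge0 ?powR_ge0//; lra.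
  by apply: ge0_ler_powR; rewrite ?nnegrE ?powR_ge0 ?(ltW zy0) ?(ltW nu0)//.
have drift' x i (lx : l < x) := drift x i (le_lt_trans lx0 lx).
have := survival_ge_power Spos HK nu0 bB l1 del1 drift' (_ : 2 * l <= y) A0 nA
  (step y _) zS zl (_ : z.1 <= y).
have [ly zy] : 2 * l <= y /\ z.1 <= y by split; lra.
move=> /(_ ly ly zy); rewrite ynu => h.
by rewrite -[W^-1]mul1r ler_pdivrMr//; move: h; rewrite /W; lra.
Qed.

End polynomial_tail.

(** * From the kernel to the chain and its hitting time *)

Section chain_survival.
Import HBNNSimple.
Context {R : realType} {S : finType}.
Local Set Implicit Arguments.
Local Unset Strict Implicit.
Variables (Sig : set (R * S)) (K : R * S -> R * S -> R).
Hypothesis Sfin : locally_finite_subset Sig.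
Hypothesis HK : stochastic_kernel Sig K.
Variables (d : measure_display) (Omega : measurableType d).
Variables (P : probability Omega R) (Z : nat -> Omega -> R * S) (z0 : R * S).
Hypothesis HZ : is_markov_chain P K z0 Z.

Let K0 z w : 0 <= K z w. Proof. by case: HK => H _; exact: H. Qed.

(** By local finiteness [B] is a countable union of finite sets, and the events that fix the value
    of [Z k] are measurable. *)
Lemma chain_measurable k (B : set (R * S)) : B `<=` Sig ->
  measurable [set om | B (Z k om)].
Proof.
move=> BS; case: Sfin => Spos Sfin'.
have -> : [set om | B (Z k om)] = \bigcup_(n in [set: nat])
    \bigcup_(w in B `&` [set w | 0 <= w.1 <= n%:R]) [set om | Z k om = w].
  apply/seteqP; split => [om /= BZ|om [n _ [w [Bw _] /= ->]]//].
  exists (Num.bound (Z k om).1) => //; exists (Z k om) => //; split => //=.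
  have Z0 : 0 <= (Z k om).1 by exact/Spos/BS.
  by rewrite Z0/=; exact/ltW/archi_boundP.
apply: bigcupT_measurable => n; apply: fin_bigcup_measurable.
  apply: sub_finite_set (Sfin' n%:R (ler0n R n)).
  by apply: setSI.
by move=> w _; case: HZ => H _; exact: H.
Qed.

Lemma path_prob_ge0 n (path : nat -> R * S) :
  0 <= (path 0%N == z0)%:R * \prod_(k < n) K (path k) (path k.+1).
Proof. by rewrite mulr_ge0// prodr_ge0. Qed.

Lemma path_measurable n (path : nat -> R * S) :
  measurable [set om | forall k, (k <= n)%N -> Z k om = path k].
Proof.
have -> : [set om | forall k, (k <= n)%N -> Z k om = path k] =
    \bigcap_(k in [set k | (k <= n)%N]) [set om | Z k om = path k].
  by apply/seteqP; split => om H k; exact: H.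
by apply: bigcap_measurableType => k _; case: HZ => H _; exact: H.
Qed.

(** Membership in [Sig] is part of the event because individual trajectories may leave [Sig], and
    [chain_measurable] covers subsets of [Sig] only. The offset [n] places the time window at the
    end of a prescribed path. *)
Definition stays_above (l : R) (n m : nat) : set Omega :=
  [set om | forall k, (k <= m)%N -> Sig (Z (n + k)%N om) /\ l < (Z (n + k)%N om).1].

Lemma stays_above_measurable l n m : measurable (stays_above l n m).
Proof.
have -> : stays_above l n m = \bigcap_(k in [set k | (k <= m)%N])
    [set om | (Sig `&` [set w | l < w.1]) (Z (n + k)%N om)].
  by apply/seteqP; split => om H k; exact: H.
apply: bigcap_measurableType => k _; apply: chain_measurable.
exact: subIsetl.
Qed.

(** Markov property as an inequality, by induction on [m] for all prefixes at once: the next state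
    is appended to the path, and the resulting disjoint events are summed. *)
Lemma path_survival_le l m n (path : nat -> R * S) : Sig (path n) ->
  (((path 0%N == z0)%:R * \prod_(k < n) K (path k) (path k.+1) *
     survival Sig K l m (path n))%:E <=
   P ([set om | forall k, (k <= n)%N -> Z k om = path k] `&` stays_above l n m))%E.
Proof.
elim: m n path => [|m IH] n path Sn; set p := _ * \prod_(k < n) _.
all: have p0 : 0 <= p by exact: path_prob_ge0.
all: have [lp|pl] := ltP l (path n).1;
  last by rewrite /= ltNge pl mul0r mulr0 measure_ge0.
  rewrite /= lp !mulr1 -(HZ.2 n path) le_measure ?inE//.
  - exact: path_measurable.
  - by apply: measurableI; [exact: path_measurable|exact: stays_above_measurable].
  - move=> om H; split => // k; rewrite leqn0 => /eqP ->.
    by rewrite addn0 H.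
have sfin : wsum Sig (K (path n)) (survival Sig K l m) \is a fin_num.
  apply: wsum_fin => //; last exact: survival_summable.
  by move=> w _; exact: survival_ge0.
rewrite /= lp mul1r EFinM fineK// -wsumZ//; last by move=> w; exact: survival_ge0.
(* The sum over [Sig] is a supremum over finite sets [X], so finitely many next states are treated
   at a time. *)
apply: ge_ereal_sup => _ [X [finX XS] <-].
pose pw (w : R * S) k := if k == n.+1 then w else path k.
have pwn w k : (k <= n)%N -> pw w k = path k.
  by move=> kn; rewrite /pw ifN// neq_ltn ltnS kn.
have pwS w : pw w n.+1 = w by rewrite /pw eqxx.
pose Ev w := [set om | forall k, (k <= n.+1)%N -> Z k om = pw w k] `&`
  stays_above l n.+1 m.
have mEv w : measurable (Ev w).
  by apply: measurableI; [exact: path_measurable|exact: stays_above_measurable].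
apply: (@le_trans _ _ (\sum_(w \in X) P (Ev w))%E).
  apply: lee_fsum => // w Xw.
  have := IH n.+1 (pw w); rewrite pwS => /(_ (XS _ Xw)).
  apply: le_trans; rewrite lee_fin big_ord_recr/= pwS !pwn//.
  rewrite [X in _ <= _ * (X * _) * _](_ : _ = \prod_(k < n) K (path k) (path k.+1)).
    by rewrite /p le_eqVlt; apply/orP; left; apply/eqP; ring.
  by apply: eq_bigr => k _; rewrite !pwn// ltnW.
(* The events are disjoint since they prescribe different states at time [n + 1]. *)
rewrite -measure_fin_bigcup//; last first.
  apply/trivIsetP => w w' _ _ ww'; apply/seteqP; split => // om [[H _] [H' _]].
  have := H n.+1 (leqnn _); rewrite (H' n.+1 (leqnn _)) !pwS => e.
  by move: ww'; rewrite e eqxx.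
apply: le_measure; rewrite ?inE.
- exact: fin_bigcup_measurable.
- by apply: measurableI; [exact: path_measurable|exact: stays_above_measurable].
- move=> om [w Xw [H H']]; split => [k kn|[_|k km]].
  + by rewrite H ?pwn// ltnW.
  + by rewrite addn0 H ?pwn.
  + by rewrite addnS -addSn; exact: H'.
Qed.

Lemma chain_survival_le l n : Sig z0 ->
  ((survival Sig K l n z0)%:E <= P (stays_above l 0 n))%E.
Proof.
move=> Sz0; have := @path_survival_le l n 0 (fun=> z0) Sz0.
rewrite eqxx big_ord0 !mul1r => /le_trans; apply.
apply: le_measure; rewrite ?inE//.
- by apply: measurableI; [exact: path_measurable|exact: stays_above_measurable].
- exact: stays_above_measurable.
Qed.

(** Markov inequality: the simple function equal to [(n + 1)^s] on the survival event and 0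
    elsewhere lies below the integrand, and the integral is a supremum over such functions. *)
Lemma hitting_time_moment_ge (x s l : R) n : x <= l -> 0 <= s -> Sig z0 ->
  ((n.+1%:R `^ s * survival Sig K l n z0)%:E <=
   \int[P]_om ((hitting_time Z x om) `^ s))%E.
Proof.
move=> xl s0 Sz0; have mE := stays_above_measurable l 0 n.
have ns0 : 0 <= n.+1%:R `^ s :> R by exact: powR_ge0.
pose h := scale_nnsfun (indic_nnsfun R mE) ns0.
rewrite ge0_integralTE; last by move=> om; exact: poweR_ge0.
apply: (@le_trans _ _ (sintegral P h)).
  rewrite (_ : sintegral P h = (n.+1%:R `^ s)%:E * P (stays_above l 0 n))%E; last first.
    by rewrite sintegralrM sintegral_indic.
  by rewrite EFinM lee_wpmul2l ?lee_fin//; exact: chain_survival_le.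
apply: ereal_sup_ubound; exists h => //= om.
have [omE|omE] := pselect (stays_above l 0 n om); last first.
  rewrite /= measurable_realfun.mindicE memNset// mulr0; exact: poweR_ge0.
rewrite /= measurable_realfun.mindicE mem_set// mulr1 -poweR_EFin.
(* Survival excludes the times 0 to [n] inclusive, so the hitting time is at least [n + 1]; it may
   be infinite. *)
have ht : (n.+1%:R%:E <= hitting_time Z x om)%E.
  apply: le_ereal_inf_tmp => _ [k /= kx <-]; rewrite lee_fin ler_nat ltnNge.
  apply/negP => kn; have [_] := omE k kn; rewrite add0n => lk.
  by have := lt_le_trans lk (le_trans kx xl); rewrite ltxx.
have n0 : (0 <= (n.+1%:R : R)%:E)%E by rewrite lee_fin.
apply: gt0_ler_poweR => //; rewrite in_itv/= leey andbT//.
exact: le_trans ht.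
Qed.

End chain_survival.

(** * Divergence of the moments of the hitting time *)

Theorem theorem2p4 (R : realType) (S : finType) (HS : (0 < #|{: S}|)%N)
  (Sig : set (R * S)) (K : R * S -> R * S -> R)
  (HSig : locally_finite_subset Sig)
  (HK : stochastic_kernel Sig K)
  (Hirr : kernel_irreducible Sig K)
  (Hlines : forall (k : S) (M : R), exists x : R, M < x /\ Sig (x, k))
  (p Cp : R) (Hp : 2 < p)
  (Hmom : forall z, Sig z -> (pmoment Sig K p z <= Cp%:E)%E)
  (Q : S -> S -> R) (HQ : irreducible_stochastic Q)
  (Hqlim : forall (i j : S) (eps : R), 0 < eps -> exists M : R, forall x : R,
      M < x -> Sig (x, i) -> `|qx Sig K i j x - Q i j| < eps)
  (pi : S -> R) (Hpi : stationary_distribution Q pi)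
  (c s2 : S -> R) (Hs2 : forall i, 0 <= s2 i) (Hs2nz : exists i, s2 i != 0)
  (Hmu : forall (i : S) (eps : R), 0 < eps -> exists M : R, forall x : R,
      M < x -> Sig (x, i) -> `|mux Sig K i x - c i / x| <= eps / x)
  (Hsig : forall (i : S) (eps : R), 0 < eps -> exists M : R, forall x : R,
      M < x -> Sig (x, i) -> `|sigma2x Sig K i x - s2 i| <= eps)
  (theta : R) (Htheta : 0 < theta <= p / 2)
  (Hcond : 0 < \sum_i (2 * c i + (2 * theta - 1) * s2 i) * pi i) :
  forall s : R, theta <= s ->
  forall x : R, 0 <= x ->
  exists y0 : R, forall z0 : R * S, Sig z0 -> y0 < z0.1 -> x < z0.1 ->
  forall (d : measure_display) (Omega : measurableType d) (P : probability Omega R)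
         (Z : nat -> Omega -> R * S),
  is_markov_chain P K z0 Z ->
  (\int[P]_om ((hitting_time Z x om) `^ s) = +oo)%E.
Proof.
move=> s ths x _; have [th0 _] := andP Htheta.
set A := \sum_i _ in Hcond; pose B := \sum_i s2 i * pi i.
have B0 : 0 <= B by apply: sumr_ge0 => i _; rewrite mulr_ge0//; case: Hpi.
(* The condition is open in theta: it survives a slight decrease of theta,
   which makes the moment [s] diverge polynomially. *)
pose t := theta - Num.min (theta / 2) (A / (2 * B + 1) / 2).
have t0 : 0 < t.
  have : Num.min (theta / 2) (A / (2 * B + 1) / 2) <= theta / 2 by rewrite ge_min lexx.
  by rewrite /t; lra.
have B1 : 0 < 2 * B + 1 by lra.
have tth : t < theta.
  by rewrite /t gtrBl lt_min !divr_gt0.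
have Ht : 0 < \sum_i (2 * c i + (2 * t - 1) * s2 i) * pi i.
  (* Lowering [theta] by [theta - t] costs [2 * (theta - t) * B], which is at most
     [A * B / (2 * B + 1)] and so less than [A]. *)
  have -> : \sum_i (2 * c i + (2 * t - 1) * s2 i) * pi i = A - 2 * (theta - t) * B.
    rewrite /A /B mulr_sumr -sumrB; apply: eq_bigr => i _; ring.
  have : theta - t <= A / (2 * B + 1) / 2.
    by rewrite /t opprB addrC subrK ge_min lexx orbT.
  move=> /(ler_wpM2r B0).
  have : A / (2 * B + 1) * (2 * B + 1) = A by rewrite divfK// gt_eqF.
  have : 0 < A / (2 * B + 1) by exact: divr_gt0.
  lra.
have [l [y0 [xl H]]] := survival_polynomial_tail x HSig.1 HK Hp Hmom HQ Hpi Hqlim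
  Hs2 Hmu Hsig t0 Ht.
exists y0 => z0 Sz0 yz0 _ d Omega P Z HZ.
have [C [C0 [n0 HC]]] := H z0 Sz0 yz0.
have s0 : 0 <= s by lra.
have st : 0 < s - t by lra.
apply/eqyP => r r0.
(* The moment is at least [C * (n + 1)^(s - t)]; this [n] makes [(n + 1)^(s - t)] at least
   [r / C]. *)
pose n := maxn n0 (Num.bound ((r / C) `^ (s - t)^-1)).
apply: le_trans (hitting_time_moment_ge HSig HK HZ n xl s0 Sz0).
rewrite lee_fin; have := HC n (leq_maxl _ _) => hC.
have n1 : 0 < n.+1%:R :> R by [].
have -> : s = (s - t) + t by rewrite subrK.
rewrite powRD; last by rewrite (gt_eqF n1) implybT.
rewrite -mulrA [X in _ <= _ * X]mulrC.
apply: le_trans (ler_wpM2l (powR_ge0 _ _) hC).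
rewrite -ler_pdivrMr//.
have rC : 0 <= r / C by rewrite divr_ge0// ltW.
have -> : r / C = ((r / C) `^ (s - t)^-1) `^ (s - t).
  by rewrite -powRrM mulVf ?gt_eqF// powRr1.
apply: ge0_ler_powR; rewrite ?nnegrE ?powR_ge0 ?(ltW st)//.
apply: (@le_trans _ _ (Num.bound ((r / C) `^ (s - t)^-1))%:R).
  by apply/ltW/archi_boundP; exact: powR_ge0.
by rewrite ler_nat (leq_trans (leq_maxr n0 _)).
Qed.
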